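(* $\mathsf{wCB}\equiv_{\mathrm{W}}\mathsf{CB}\equiv_{\mathrm{W}}\widehat{\mathsf{WF}}$.
   Context: A represented space is a set $X$ with a partial surjection $\delta_X:\subseteq\mathbb{N}^{\mathbb{N}}\to X$; $p$ is a name of $x$ if $\delta_X(p)=x$. A problem is a partial multi-valued function $f:\subseteq X\rightrightarrows Y$ between represented spaces. $f\le_{\mathrm{W}} g$ (Weihrauch reducibility) means that there are computable partial maps $\Phi,\Psi:\subseteq\mathbb{N}^{\mathbb{N}}\to\mathbb{N}^{\mathbb{N}}$ such that for every name $p$ of some $x\in\mathrm{dom}(f)$, $\Phi(p)$ is a name of some $y\in\mathrm{dom}(g)$, and for every name $q$ of an element of $g(y)$, $\Psi(p*q)$ is a name of an element of $f(x)$, where $p*q$ is the interleaving of $p$ and $q$. $f\equiv_{\mathrm{W}}g$ means reducibility both ways. The infinite parallelization of $f$ is $\widehat f((x_i)_{i\in\mathbb{N}})=\{(y_i)_{i\in\mathbb{N}}:(\forall i)\,y_i\in f(x_i)\}$. A tree is a subset $T$ of $\mathbb{N}^{<\mathbb{N}}$ closed under initial segments (the empty set is allowed); $[T]$ is its set of infinite paths; $T$ is well-founded if $[T]=\emptyset$. $\mathbf{Tr}$ is the space of trees, a tree being represented by its characteristic function (via a fixed computable bijection $\mathbb{N}^{<\mathbb{N}}\cong\mathbb{N}$). $\mathbb{N}$, $2=\{0,1\}$, $\mathbb{N}^{\mathbb{N}}$, products and sequence spaces carry the standard representations. $\mathsf{WF}:\mathbf{Tr}\to\{0,1\}$ is given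 by $\mathsf{WF}(T)=1$ iff $T$ is well-founded. A tree is perfect if each of its elements has two incomparable extensions in it; the perfect kernel $\mathsf{PK}(T)$ of a tree $T$ is its largest perfect subtree, and the scattered part of $T$ is the (countable) set $[T]\setminus[\mathsf{PK}(T)]$; equivalently it is $[T]\setminus P$, where $P$ is the unique perfect closed set (closed without isolated points) contained in $[T]$ with countable complement in $[T]$. $\mathsf{wCB}:\mathbf{Tr}\rightrightarrows\mathbf{Tr}\times(2\times\mathbb{N}^{\mathbb{N}})^{\mathbb{N}}$ maps every tree $T$ to the set of all $(\mathsf{PK}(T),(b_i,x_i)_{i\in\mathbb{N}})$ with $[T]\setminus[\mathsf{PK}(T)]=\{x_i:b_i=1\}$. $\mathsf{CB}:\mathbf{Tr}\rightrightarrows\mathbf{Tr}\times(\mathbb{N}\times(2\times\mathbb{N}^{\mathbb{N}})^{\mathbb{N}})$ maps every tree $T$ to the set of all $(\mathsf{PK}(T),(n,(b_i,x_i)_{i\in\mathbb{N}}))$ with $[T]\setminus[\mathsf{PK}(T)]=\{x_i:b_i=1\}$ and $n=0$ if $[T]\setminus[\mathsf{PK}(T)]$ is infinite, $n=|[T]\setminus[\mathsf{PK}(T)]|+1$ if it is finite. *)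

(* Defs.v *)
From Stdlib Require List Cantor.
From mathcomp Require Import all_boot all_classical.

Set Implicit Arguments.
Unset Strict Implicit.
Unset Printing Implicit Defensive.

Local Open Scope classical_set_scope.

(** * Computable partial maps on Baire space *)

Notation baire := (nat -> nat).

(* Kleene's partial recursive functions relative to an oracle [p : baire].
   Codes carry no arity: they are evaluated on lists of arguments, and a
   missing argument is read as 0. *)
Inductive code : Type :=
| Zero
| Succ
| Proj of nat
| Oracle
| Comp of code & seq code
| PrimRec of code & code
| Mu of code.

(* [eval p c v y]: the function coded by [c] with oracle [p] is defined on [v],
   with value [y].  [PrimRec f g] recurses on its first argument, with
   h(0, v) = f(v) and h(i + 1, v) = g(i, h(i, v), v); [Mu f] maps v to the least
   y with f(y, v) = 0, all smaller arguments giving a defined nonzero value. *)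
Fixpoint eval (p : baire) (c : code) (v : seq nat) : set nat :=
  match c with
  | Zero => [set 0]
  | Succ => [set (head 0 v).+1]
  | Proj i => [set nth 0 v i]
  | Oracle => [set p (head 0 v)]
  | Comp f gs => [set y | exists2 w : seq nat,
      List.Forall2 (fun (D : set nat) a => D a) [seq eval p g v | g <- gs] w &
      eval p f w y]
  | PrimRec f g =>
      iteri (head 0 v)
        (fun i (D : set nat) =>
           [set y | exists2 z, D z & eval p g [:: i, z & behead v] y])
        (eval p f (behead v))
  | Mu f => [set y | eval p f (y :: v) 0 /\
      forall i, i < y -> exists k, eval p f (i :: v) k.+1]
  end.

Lemma eval_functional p c v y z : eval p c v y -> eval p c v z -> y = z.
Proof.
move: c v y z; fix IH 1 => c v y z.
case: c => [||i||f gs|f g|f] /=; do ?by move=> -> ->.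
- move=> [w gsw fw] [w' gsw' fw']; suff E : w = w'.
    by move: fw'; rewrite -E; apply: IH fw.
  move: gs w w' gsw gsw' {fw fw'}.
  fix IHs 1 => -[|g gs] w w' /=; first by move=> gw gw'; inversion gw; inversion gw'.
  move=> gw gw'; inversion gw; inversion gw'; congr cons; last exact: (IHs gs).
  by apply: (IH g); eassumption.
- elim: (head 0 v) y z => [|n IHn] y z /=; first exact: IH.
  by move=> [a /IHn aE ga] [b /aE <-]; apply: IH ga.
- move=> [fy ltf] [fz ltf']; case: (ltngtP y z) => // [yz|zy].
  + by have [k fk] := ltf' _ yz; have := IH _ _ _ _ fy fk.
  + by have [k fk] := ltf _ zy; have := IH _ _ _ _ fz fk.
Qed.

Definition computes (c : code) (p r : baire) : Prop :=
  forall n, eval p c [:: n] (r n).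

Definition computable (F : baire -> option baire) : Prop :=
  exists c, forall p r, F p = Some r -> computes c p r.

(** * Represented spaces *)

Definition interleave (p q : baire) : baire :=
  fun n => if odd n then q n./2 else p n./2.

Definition evens (p : baire) : baire := fun n => p n.*2.
Definition odds (p : baire) : baire := fun n => p n.*2.+1.

Lemma evens_interleave p q : evens (interleave p q) = p.
Proof. by apply/funext => n; rewrite /evens /interleave odd_double doubleK. Qed.

Lemma odds_interleave p q : odds (interleave p q) = q.
Proof.
by apply/funext => n; rewrite /odds /interleave /= odd_double uphalf_double.
Qed.

Lemma interleave_evens_odds p : interleave (evens p) (odds p) = p.
Proof.
apply/funext => n; rewrite /interleave /evens /odds -[in RHS](odd_double_half n).
by case: (odd n).
Qed.

(* The partial surjection is given by its graph: [name p x] says that [p] is a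
   name of [x]. *)
Record rep_space : Type := RepSpace {
  points :> Type;
  name : baire -> points -> Prop;
  name_functional : forall p x y, name p x -> name p y -> x = y;
  name_surjective : forall x, exists p, name p x
}.

Arguments name : clear implicits.
Arguments name {r}.

Program Definition natS : rep_space :=
  @RepSpace nat (fun p n => p 0 = n) _ _.
Next Obligation. by move=> p x y <- <-. Qed.
Next Obligation. by move=> x; exists (fun=> x). Qed.

Program Definition boolS : rep_space :=
  @RepSpace bool (fun p b => p 0 = b) _ _.
Next Obligation. by move=> p [] [] //= E E'; move: E'; rewrite E. Qed.
Next Obligation. by move=> x; exists (fun=> x). Qed.

Program Definition baireS : rep_space :=
  @RepSpace baire (fun p x => p = x) _ _.
Next Obligation. by move=> p x y <- <-. Qed.
Next Obligation. by move=> x; exists x. Qed.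

Program Definition prodS (X Y : rep_space) : rep_space :=
  @RepSpace (X * Y)%type
    (fun p z => name (evens p) z.1 /\ name (odds p) z.2) _ _.
Next Obligation.
move=> X Y p [x y] [x' y'] /= [px py] [px' py'].
by congr pair; [apply: name_functional px px' | apply: name_functional py py'].
Qed.
Next Obligation.
move=> X Y [x y].
have [p px] := name_surjective x; have [q qy] := name_surjective y.
by exists (interleave p q); rewrite evens_interleave odds_interleave.
Qed.

Definition column (p : baire) (i : nat) : baire := fun n => p (Cantor.to_nat (i, n)).

Program Definition seqS (X : rep_space) : rep_space :=
  @RepSpace (nat -> X) (fun p x => forall i, name (column p i) (x i)) _ _.
Next Obligation.
move=> X p x y px py.
by apply/funext => i; apply: name_functional (px i) (py i).
Qed.
Next Obligation.
move=> X x; have /choice[q qx] := fun i => name_surjective (x i).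
exists (fun k => let: (i, n) := Cantor.of_nat k in q i n) => i.
suff -> : column (fun k => let: (i, n) := Cantor.of_nat k in q i n) i = q i by [].
by apply/funext => n; rewrite /column Cantor.cancel_of_to.
Qed.

(** * Trees *)

Record tree : Type := Tree {
  nodes :> set (seq nat);
  tree_closed : forall s t, prefix s t -> nodes t -> nodes s
}.

Lemma tree_ext (S T : tree) : nodes S = nodes T -> S = T.
Proof.
case: S T => [S cS] [T cT] /= E; move: cS cT; rewrite E => cS cT.
by congr Tree; apply: Prop_irrelevance.
Qed.

Program Definition Tr : rep_space :=
  @RepSpace tree
    (fun p T => forall s, p (CodeSeq.code s) = `[< nodes T s >] :> nat) _ _.
Next Obligation.
move=> p S T pS pT; apply/tree_ext/funext => s; apply/propext.
have : (`[< nodes S s >] : nat) = `[< nodes T s >] by rewrite -pS -pT.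
by case: asboolP; case: asboolP.
Qed.
Next Obligation.
move=> T; exists (fun k => `[< nodes T (CodeSeq.decode k) >]) => s.
by rewrite CodeSeq.codeK.
Qed.

Definition paths (T : tree) : set baire := [set x | forall n, nodes T (mkseq x n)].

Definition well_founded (T : tree) : Prop := paths T = set0.

Definition perfect (T : tree) : Prop :=
  forall s, nodes T s -> exists t u,
    [/\ nodes T t, nodes T u, prefix s t, prefix s u & ~~ prefix t u && ~~ prefix u t].

(* The perfect kernel is built as the union of all perfect subtrees;
   [PK_perfect], [PK_sub] and [PK_largest] show that it is the largest one. *)
Program Definition PK (T : tree) : tree :=
  @Tree [set s | exists S : tree, [/\ perfect S, S `<=` T & nodes S s]] _.
Next Obligation.
move=> T s t st [S [pS ST St]]; exists S; split=> //.
exact: tree_closed st St.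
Qed.

Lemma PK_sub (T : tree) : PK T `<=` T.
Proof. by move=> s [S [_ ST]] /ST. Qed.

Lemma PK_perfect T : perfect (PK T).
Proof.
move=> s [S [pS ST /pS[t [u [St Su st su tu]]]]].
by exists t, u; split=> //; exists S.
Qed.

Lemma PK_largest (T S : tree) : perfect S -> S `<=` T -> S `<=` PK T.
Proof. by move=> pS ST s Ss; exists S. Qed.

Definition scattered_part (T : tree) : set baire := paths T `\` paths (PK T).

(** * Problems and Weihrauch reducibility *)

(* A partial multi-valued function is a relation; its domain consists of the
   points with at least one value. *)
Definition problem (X Y : rep_space) : Type := X -> set Y.

Definition dom (X Y : rep_space) (f : problem X Y) : set X :=
  [set x | f x !=set0].

Definition weihrauch_le (X Y Z W : rep_space)
    (f : problem X Y) (g : problem Z W) : Prop :=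
  exists Phi Psi : baire -> option baire,
    [/\ computable Phi, computable Psi &
    forall p x, name p x -> dom f x ->
      exists p' z,
        [/\ Phi p = Some p', name p' z, dom g z &
        forall q w, name q w -> g z w ->
          exists r y,
            [/\ Psi (interleave p q) = Some r, name r y & f x y]]].

Definition weihrauch_equiv (X Y Z W : rep_space)
    (f : problem X Y) (g : problem Z W) : Prop :=
  weihrauch_le f g /\ weihrauch_le g f.

Definition parallelization (X Y : rep_space) (f : problem X Y) :
    problem (seqS X) (seqS Y) :=
  fun x => [set y | forall i, f (x i) (y i)].

Definition WF : problem Tr boolS :=
  fun T => [set b | b = true <-> well_founded T].

Definition wCB : problem Tr (prodS Tr (seqS (prodS boolS baireS))) :=
  fun T => [set K_bx |
    K_bx.1 = PK T /\
    scattered_part T = [set x | exists i, K_bx.2 i = (true, x)]].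

Definition CB :
    problem Tr (prodS Tr (prodS natS (seqS (prodS boolS baireS)))) :=
  fun T => [set K_n_bx |
    [/\ K_n_bx.1 = PK T,
        scattered_part T = [set x | exists i, K_n_bx.2.2 i = (true, x)],
        infinite_set (scattered_part T) -> K_n_bx.2.1 = 0 &
        forall k, (scattered_part T #= `I_k)%card -> K_n_bx.2.1 = k.+1]].

(** * The problems are total *)

Lemma dom_WF T : dom WF T.
Proof. by exists `[< well_founded T >]; split=> /asboolP. Qed.

Definition paths_through (T : tree) (s : seq nat) : set baire :=
  [set x | paths T x /\ mkseq x (size s) = s].

Lemma prefix_mkseq (x : baire) m n : m <= n -> prefix (mkseq x m) (mkseq x n).
Proof.
move=> mn; rewrite prefixE size_mkseq /mkseq -map_take take_iota.
by rewrite (minn_idPl mn).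
Qed.

Lemma paths_through_prefix T s t :
  prefix s t -> paths_through T t `<=` paths_through T s.
Proof.
move=> st x [Tx xt]; split=> //.
have lst : size s <= size t by case/prefixP: st => r ->; rewrite size_cat leq_addr.
have := prefix_mkseq x lst; rewrite xt prefixE size_mkseq => /eqP <-.
by move: st; rewrite prefixE => /eqP.
Qed.

Program Definition uncountable_tree (T : tree) : tree :=
  @Tree [set s | ~ countable (paths_through T s)] _.
Next Obligation.
move=> T s t st; apply: contra_not => cs; apply: sub_countable cs.
by apply/subset_card_le/paths_through_prefix.
Qed.

Lemma uncountable_tree_sub (T : tree) : uncountable_tree T `<=` T.
Proof.
move=> s /= us; have [x [Tx <-]] : paths_through T s !=set0; last exact: Tx.
by apply/set0P/eqP => s0; apply: us; rewrite s0.
Qed.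

Lemma uncountable_tree_perfect T : perfect (uncountable_tree T).
Proof.
move=> s us; apply: contrapT => noext; apply: (us).
pose thin := [set x | paths_through T s x /\
  forall n, nodes (uncountable_tree T) (mkseq x n)].
pose fat := \bigcup_(t in [set t | countable (paths_through T t)])
  paths_through T t.
have : paths_through T s `<=` thin `|` fat.
  move=> x sx; have [Ux|/existsNP[n nU]] :=
    pselect (forall n, nodes (uncountable_tree T) (mkseq x n)); [by left | right].
  exists (mkseq x n) => /=; first exact: contrapT nU.
  by split; [case: sx | rewrite size_mkseq].
move=> /subset_card_le/sub_countable; apply.
rewrite -bigcup2E; apply: bigcup_countable => // -[|[|i]] _ //=; last first.
  by apply: bigcup_countable.
apply/countable_injP; exists (fun=> 0) => x y.
rewrite !inE => -[[Tx sx] Ux] [[Ty sy] Uy] _; apply/funext => k.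
pose n := maxn k.+1 (size s).
have ls : size s <= n by rewrite leq_maxr.
have px : prefix s (mkseq x n) by rewrite -{1}sx prefix_mkseq.
have py : prefix s (mkseq y n) by rewrite -{1}sy prefix_mkseq.
have kn : k < n by rewrite leq_maxl.
suff E : mkseq x n = mkseq y n by rewrite -(nth_mkseq 0 x kn) E nth_mkseq.
apply: contrapT => /eqP nE; apply: noext; exists (mkseq x n), (mkseq y n).
split=> //; rewrite !prefixE !size_mkseq !take_oversize ?size_mkseq //.
by rewrite nE eq_sym nE.
Qed.

Lemma countable_scattered_part T : countable (scattered_part T).
Proof.
have : scattered_part T `<=`
    \bigcup_(t in [set t | countable (paths_through T t)]) paths_through T t.
  move=> x [Tx /existsNP[n nK]]; exists (mkseq x n) => /=.
    apply: contrapT => ux; apply: nK.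
    by apply: (@PK_largest _ (uncountable_tree T)) ux;
      [exact: uncountable_tree_perfect | exact: uncountable_tree_sub].
  by split=> //; rewrite size_mkseq.
move=> /subset_card_le/sub_countable; apply.
exact: bigcup_countable.
Qed.

Lemma dom_wCB T : dom wCB T.
Proof.
have /countable_injP[f finj] := countable_scattered_part T.
have /choice[bx bxP] : forall i, exists z : bool * baire,
    (z.1 = true <-> exists2 x, scattered_part T x & f x = i) /\
    (z.1 = true -> scattered_part T z.2 /\ f z.2 = i).
  move=> i; have [[x Sx fx]|no] :=
    pselect (exists2 x, scattered_part T x & f x = i).
    by exists (true, x); split=> //=; split=> // _; exists x.
  by exists (false, id).
exists (PK T, bx); split=> //=; apply/seteqP; split=> [x Sx|x [i E]].
  have [[_ /(_ _)b1] /(_ _)b2] := bxP (f x); exists (f x).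
  have b : (bx (f x)).1 = true by apply: b1; exists x.
  have [Sz fz] := b2 b; rewrite [bx _]surjective_pairing b.
  by congr pair; apply: finj; rewrite ?inE.
by have [_] := bxP i; rewrite E => /(_ erefl)[].
Qed.

Lemma dom_CB T : dom CB T.
Proof.
have [[K bx] [/= KE bxE]] := dom_wCB T.
have [[k Sk]|inf] := pselect (finite_set (scattered_part T)); last first.
  by exists (K, (0, bx)); split=> //= k Sk; case: inf; exists k.
exists (K, (k.+1, bx)); split=> //= [[]|j Sj]; first by exists k.
congr S; apply/card_eq_II.
by apply: card_eq_trans Sj; rewrite card_eq_sym.
Qed.

(* Main.v *)
(* Only CB <= WF^ is hard.  Call two incomparable extensions of a node s in T a
   fork of s, and give the nodes outside of the kernel ranks: the rank of s is
   the supremum, over the forks (a, b) of s, of min(rank a, rank b) + 1; nodes of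
   the kernel have rank oo.  If s is outside of the kernel, then of two
   incomparable extensions of s one has a smaller rank than s, so that from s
   there is at most one way to proceed in T without losing rank.  Call s dead if
   this way ends.  Along a scattered path the ranks are eventually constant; hence
   the scattered paths are exactly those that lead from the nodes that are not
   dead, and there are fewer than k of them iff every antichain of k nodes has a
   dead member.  "The rank of t is less than that of s" (with oo < oo) is a
   greatest fixed point, so that it is Sigma^1_1, and so are "s is dead" and the
   finiteness of the scattered part.  Each instance is thus the ill-foundedness of
   a tree computable from T, and WF^ decides all of them at once; the leading
   paths are then found by search.  Conversely, WF(T_i) is read off the perfect
   kernel of a tree that has a copy of T_i with all branches doubled above [i]. *)

Require Import Defs.
From Stdlib Require List Cantor.
From mathcomp Require Import all_boot all_classical.

Set Implicit Arguments.
Unset Strict Implicit.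
Unset Printing Implicit Defensive.

Local Open Scope classical_set_scope.

(** * Recursive functions of a context *)

(* The functions considered have several arguments and an oracle: a context
   determines the oracle and the arguments, and new arguments are added by
   pairing.  The oracles of a context need not range over all of Baire space,
   which makes unbounded search total on valid inputs. *)
Structure context : Type := Context {
  inputs :> Type;
  orc : inputs -> baire;
  vals : inputs -> seq nat;
  arity : nat;
  size_vals : forall x, size (vals x) = arity }.

Structure coded : Type := Coded { values :> Type; enc : values -> nat }.

Canonical coded_nat := @Coded nat id.
Canonical coded_bool := @Coded bool nat_of_bool.
Canonical coded_seq := @Coded (seq nat) CodeSeq.code.

Canonical context_baire := @Context baire id (fun=> [::]) 0 (fun=> erefl).

(** The newest variable heads the argument list, so that the projections out of nested pairs act as
    de Bruijn indices. *)
Canonical context_prod (X : context) (A : coded) :=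
  @Context (X * A)%type (fun z => orc z.1) (fun z => enc z.2 :: vals z.1)
    (arity X).+1 (fun z => congr1 succn (size_vals z.1)).

Definition recursive (X : context) (A : coded) (F : X -> A) : Prop :=
  exists c, forall x, eval (orc x) c (vals x) (enc (F x)).

(** A substitution: the oracle stays, and the new argument list is computed entry by entry, in the
    form that [Comp] takes. *)
Definition reindexing (X Y : context) (h : X -> Y) : Prop :=
  (forall x, orc (h x) = orc x) /\
  exists cs, forall x, List.Forall2 (fun (D : set nat) a => D a)
    [seq eval (orc x) g (vals x) | g <- cs] (vals (h x)).

Section Closure.
Variable X : context.

Lemma rec_comp (Y : context) (A : coded) (h : X -> Y) (F : Y -> A) :
  reindexing h -> recursive F -> recursive (fun x => F (h x)).
Proof.
move=> [ho [cs hcs]] [c cF]; exists (Comp c cs) => x /=.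
by exists (vals (h x)) => //; rewrite -ho.
Qed.

Lemma reindexing_pair (Y : context) (A : coded) (h : X -> Y) (a : X -> A) :
  reindexing h -> recursive a -> reindexing (fun x => (h x, a x)).
Proof.
move=> [ho [cs hcs]] [c cF]; split=> //=; exists (c :: cs) => x /=.
by constructor.
Qed.

Lemma reindexing_orc : reindexing (@orc X).
Proof. by split=> //; exists [::] => x; constructor. Qed.

Lemma reindexing_fst (A : coded) : reindexing (@fst X A).
Proof.
split=> //; exists [seq Proj i.+1 | i <- iota 0 (arity X)] => -[x a] /=.
rewrite -(size_vals x); set o := orc x; set u := enc a.
(* Generalized over the variables [t] already passed; the shift in [Proj i.+1] skips the variable
   that [fst] forgets. *)
suff H (s t : seq nat) : List.Forall2 (fun (D : set nat) a => D a)
    [seq eval o g (u :: t ++ s) | g <- [seq Proj i.+1 | i <- iota (size t) (size s)]] s.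
  exact: (H (vals x) [::]).
elim: s t => [|b s IHs] t /=; first by constructor.
constructor=> /=; first by rewrite nth_cat ltnn subnn.
by have := IHs (rcons t b); rewrite size_rcons cat_rcons.
Qed.

Lemma reindexing_id : reindexing (@id X).
Proof.
split=> //; exists [seq Proj i | i <- iota 0 (arity X)] => x /=.
rewrite -(size_vals x); set o := orc x.
suff H (s t : seq nat) : List.Forall2 (fun (D : set nat) a => D a)
    [seq eval o g (t ++ s) | g <- [seq Proj i | i <- iota (size t) (size s)]] s.
  exact: (H (vals x) [::]).
elim: s t => [|b s IHs] t /=; first by constructor.
constructor=> /=; first by rewrite nth_cat ltnn subnn.
by have := IHs (rcons t b); rewrite size_rcons cat_rcons.
Qed.

Lemma reindexing_comp (Y Z : context) (h : X -> Y) (k : Y -> Z) :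
  reindexing h -> reindexing k -> reindexing (fun x => k (h x)).
Proof.
move=> hh [ko [ds kds]]; have [ho [cs hcs]] := hh; split=> [x|]; first by rewrite ko ho.
exists [seq Comp d cs | d <- ds] => x.
have := kds (h x); rewrite ho; elim: ds (vals (k (h x))) {kds} => [|d ds IH] s /= H;
  inversion H; constructor; subst; last exact: IH.
by exists (vals (h x)).
Qed.

Lemma rec_ext (A : coded) (F G : X -> A) :
  (forall x, F x = G x) -> recursive F -> recursive G.
Proof. by move=> FG [c cF]; exists c => x; rewrite -FG. Qed.

Lemma rec_enc (A : coded) (F : X -> A) :
  recursive F <-> recursive (fun x => enc (F x) : nat).
Proof. by split=> -[c cF]; exists c. Qed.

Lemma rec_var0 (A : coded) : recursive (fun z : X * A => z.2).
Proof. by exists (Proj 0). Qed.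

Lemma rec_const (A : coded) (a : A) : recursive (fun _ : X => a).
Proof.
have [c cE] : exists c, forall p v, eval p c v (enc a).
  elim: (enc a) => [|n [c cE]]; first by exists Zero.
  exists (Comp Succ [:: c]) => p v /=; exists [:: n] => //.
  by constructor=> //; constructor.
by exists c.
Qed.

Lemma rec_let (A B : coded) (a : X -> A) (F : X -> A -> B) :
  recursive a -> recursive (fun z : X * A => F z.1 z.2) ->
  recursive (fun x => F x (a x)).
Proof.
move=> ra rF; apply: (rec_comp (h := fun x => (x, a x)) _ rF).
by apply: reindexing_pair ra; apply: reindexing_id.
Qed.

(** [P] stands for any expression of the oracle, such as the first component of a nested pair. *)
Lemma rec_orc (P : X -> baire) (N : X -> nat) :
  (forall x, P x = orc x) -> recursive N -> recursive (fun x => P x (N x)).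
Proof.
move=> PE [c cN]; exists (Comp Oracle [:: c]) => x /=; exists [:: N x].
  by constructor=> //; constructor.
by rewrite PE.
Qed.

Lemma rec_succn (N : X -> nat) : recursive N -> recursive (fun x => (N x).+1).
Proof.
move=> [c cN]; exists (Comp Succ [:: c]) => x /=; exists [:: N x] => //.
by constructor=> //; constructor.
Qed.

(** The context [X * A * nat] lists the arguments as [PrimRec] passes them: index, accumulator,
    parameters. *)
Lemma rec_iteri (A : coded) (n : X -> nat) (g : X -> nat -> A -> A) (a : X -> A) :
  recursive n -> recursive (fun z : X * A * nat => g z.1.1 z.2 z.1.2) ->
  recursive a -> recursive (fun x => iteri (n x) (g x) (a x)).
Proof.
move=> rn [c cg] [d da].
have : recursive (fun z : X * nat => iteri z.2 (g z.1) (a z.1)).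
  exists (PrimRec d c) => -[x m] /=; elim: m => [|m IHm] /=; first exact: da.
  by exists (enc (iteri m (g x) (a x))) => //; exact: (cg (x, iteri m (g x) (a x), m)).
exact: (rec_let (F := fun x m => iteri m (g x) (a x))) rn.
Qed.

End Closure.

Lemma rec_wk (X : context) (A B : coded) (F : X -> A) :
  recursive F -> recursive (fun z : X * B => F z.1).
Proof. exact/rec_comp/reindexing_fst. Qed.

Section Search.
Variable X : context.

Lemma rec_least (f : X -> nat -> bool) (G : X -> nat) :
  recursive (fun z : X * nat => f z.1 z.2) ->
  (forall x, f x (G x)) -> (forall x i, i < G x -> ~~ f x i) ->
  recursive G.
Proof.
move=> rf fG fltG.
(* [Mu] looks for a zero, so the truth value is turned into 0 if [f] holds and into 1 otherwise. *)
have [c cf] : recursive (fun z : X * nat => iteri (f z.1 z.2) (fun _ _ => 0) 1).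
  apply: (rec_iteri (n := fun z => f z.1 z.2 : nat)); last exact: rec_const.
    by case: rf => c; exists c.
  exact: rec_const.
exists (Mu c) => x /=; split.
  by have := cf (x, G x); rewrite /= fG.
by move=> i /fltG fi; exists 0; have := cf (x, i); rewrite /= (negPf fi).
Qed.

(** Serves to invert codings, whose graphs are recursive because the codings are. *)
Lemma rec_unique (f : X -> nat -> bool) (G : X -> nat) :
  recursive (fun z : X * nat => f z.1 z.2) ->
  (forall x i, f x i = (i == G x)) -> recursive G.
Proof.
move=> rf fE; apply: (rec_least rf) => [x|x i]; first by rewrite fE.
by rewrite fE ltn_neqAle => /andP[].
Qed.

Lemma rec_if (A : coded) (b : X -> bool) (u v : X -> A) :
  recursive b -> recursive u -> recursive v ->
  recursive (fun x => if b x then u x else v x).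
Proof.
move=> rb ru rv.
suff : recursive (fun x => iteri (b x) (fun _ _ => u x) (v x)).
  by apply: rec_ext => x; case: (b x).
apply: rec_iteri => //.
exact: (rec_wk _ (F := fun z => u z.1)) (rec_wk _ ru).
Qed.

End Search.

Section Functions.
Variables (X : context) (A B C : coded).

(** Reduces an arbitrary context to a single variable, so that searches are set up with few
    variables in scope. *)
Lemma rec_fun1 (f : A -> B) (a : X -> A) :
  recursive (fun z : baire * A => f z.2) ->
  recursive a -> recursive (fun x => f (a x)).
Proof.
move=> rf ra; apply: (rec_comp (h := fun x => (orc x, a x)) _ rf).
by apply: reindexing_pair ra; apply: reindexing_orc.
Qed.

Lemma rec_fun2 (f : A -> B -> C) (a : X -> A) (b : X -> B) :
  recursive (fun z : baire * A * B => f z.1.2 z.2) ->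
  recursive a -> recursive b -> recursive (fun x => f (a x) (b x)).
Proof.
move=> rf ra rb; apply: (rec_comp (h := fun x => (orc x, a x, b x)) _ rf).
by do 2!apply: reindexing_pair => //; apply: reindexing_orc.
Qed.

End Functions.

Lemma rec_var1 (X : context) (A B : coded) : recursive (fun z : X * A * B => z.1.2).
Proof. exact: (rec_wk _ (rec_var0 _ _)). Qed.

Lemma rec_var2 (X : context) (A B C : coded) :
  recursive (fun z : X * A * B * C => z.1.1.2).
Proof. exact: (rec_wk _ (rec_var1 _ _ _)). Qed.

Lemma rec_var3 (X : context) (A B C D : coded) :
  recursive (fun z : X * A * B * C * D => z.1.1.1.2).
Proof. exact: (rec_wk _ (rec_var2 _ _ _ _)). Qed.

Ltac rec_atom := first
  [ exact: rec_const | exact: rec_var0 | exact: rec_var1 | exact: rec_var2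
  | exact: rec_var3 | assumption ].

(** * Arithmetic and Boolean operations *)

Lemma rec_addn (X : context) (a b : X -> nat) :
  recursive a -> recursive b -> recursive (fun x => a x + b x).
Proof.
move=> ra rb; suff : recursive (fun x => iteri (a x) (fun _ => succn) (b x)).
  by apply: rec_ext => x; elim: (a x) => //= n ->.
by apply: rec_iteri => //; apply: rec_succn; rec_atom.
Qed.

Lemma rec_predn (X : context) (a : X -> nat) :
  recursive a -> recursive (fun x => (a x).-1).
Proof.
move=> ra; suff : recursive (fun x => iteri (a x) (fun i _ => i) 0).
  by apply: rec_ext => x; case: (a x).
by apply: rec_iteri => //; rec_atom.
Qed.

Lemma rec_subn (X : context) (a b : X -> nat) :
  recursive a -> recursive b -> recursive (fun x => a x - b x).
Proof.
move=> ra rb; suff : recursive (fun x => iteri (b x) (fun _ => predn) (a x)).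
  by apply: rec_ext => x; elim: (b x) => [|n]; rewrite ?subn0 ?subnS //= => ->.
by apply: rec_iteri => //; apply: rec_predn; rec_atom.
Qed.

Lemma rec_muln (X : context) (a b : X -> nat) :
  recursive a -> recursive b -> recursive (fun x => a x * b x).
Proof.
apply: rec_fun2.
suff : recursive (fun z : baire * nat * nat => iteri z.1.2 (fun _ => addn z.2) 0).
  by apply: rec_ext => x; elim: x.1.2 => //= n ->; rewrite mulSn.
by apply: rec_iteri; [rec_atom | apply: rec_addn; rec_atom | rec_atom].
Qed.

Lemma rec_expn (X : context) (a b : X -> nat) :
  recursive a -> recursive b -> recursive (fun x => a x ^ b x).
Proof.
apply: rec_fun2.
suff : recursive (fun z : baire * nat * nat => iteri z.2 (fun _ => muln z.1.2) 1).
  by apply: rec_ext => x; elim: x.2 => //= n ->; rewrite expnS.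
by apply: rec_iteri; [rec_atom | apply: rec_muln; rec_atom | rec_atom].
Qed.

Lemma rec_natb (X : context) (b : X -> bool) :
  recursive b -> recursive (fun x => b x : nat).
Proof. by []. Qed.

Lemma rec_negb (X : context) (b : X -> bool) :
  recursive b -> recursive (fun x => ~~ b x).
Proof. by move=> rb; apply: (rec_if rb); rec_atom. Qed.

Lemma rec_andb (X : context) (b c : X -> bool) :
  recursive b -> recursive c -> recursive (fun x => b x && c x).
Proof. by move=> rb rc; apply: (rec_if rb); rec_atom. Qed.

Lemma rec_orb (X : context) (b c : X -> bool) :
  recursive b -> recursive c -> recursive (fun x => b x || c x).
Proof. by move=> rb rc; apply: (rec_if rb); rec_atom. Qed.

Lemma rec_implyb (X : context) (b c : X -> bool) :
  recursive b -> recursive c -> recursive (fun x => b x ==> c x).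
Proof. by move=> rb rc; apply: (rec_if rb); rec_atom. Qed.

Lemma rec_leq (X : context) (a b : X -> nat) :
  recursive a -> recursive b -> recursive (fun x => a x <= b x).
Proof.
move=> ra rb; suff : recursive (fun x => iteri (a x - b x) (fun _ _ => false) true).
  by apply: rec_ext => x; rewrite /leq; case: (a x - b x).
by apply: rec_iteri; [exact: rec_subn | rec_atom..].
Qed.

Lemma rec_eqn (X : context) (a b : X -> nat) :
  recursive a -> recursive b -> recursive (fun x => a x == b x).
Proof.
move=> ra rb; suff : recursive (fun x => (a x <= b x) && (b x <= a x)).
  by apply: rec_ext => x; rewrite eqn_leq.
by apply: rec_andb; apply: rec_leq.
Qed.

Lemma rec_odd (X : context) (a : X -> nat) :
  recursive a -> recursive (fun x => odd (a x)).
Proof.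
move=> ra; suff : recursive (fun x => iteri (a x) (fun _ => negb) false).
  by apply: rec_ext => x; elim: (a x) => //= n ->.
by apply: rec_iteri; [|apply: rec_negb|]; rec_atom.
Qed.

Lemma rec_half (X : context) (a : X -> nat) :
  recursive a -> recursive (fun x => (a x)./2).
Proof.
move=> ra; suff : recursive (fun x => iteri (a x) (fun i h => odd i + h) 0).
  apply: rec_ext => x; elim: (a x) => //= n ->.
  by rewrite uphalf_half.
apply: rec_iteri => //; last by rec_atom.
by apply: rec_addn; [apply/rec_natb/rec_odd|]; rec_atom.
Qed.

Lemma rec_double (X : context) (a : X -> nat) :
  recursive a -> recursive (fun x => (a x).*2).
Proof.
by move=> ra; apply: (rec_ext (F := fun x => a x + a x)) => [x|]; rewrite ?addnn //;
  apply: rec_addn.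
Qed.

Lemma rec_all (X : context) (P : X -> nat -> bool) (n : X -> nat) :
  recursive (fun z : X * nat => P z.1 z.2) -> recursive n ->
  recursive (fun x => all (P x) (iota 0 (n x))).
Proof.
move=> rP rn.
suff : recursive (fun x => iteri (n x) (fun i b => P x i && b) true).
  apply: rec_ext => x; elim: (n x) => // k IHk.
  by rewrite -addn1 iotaD all_cat -IHk addn1 /= andbT andbC.
apply: rec_iteri => //; last by rec_atom.
apply: rec_andb; last by rec_atom.
apply: (rec_comp (h := fun z : X * bool * nat => (z.1.1, z.2))) rP.
apply: reindexing_pair; last by rec_atom.
exact: (reindexing_comp (reindexing_fst _ _) (reindexing_fst _ _)).
Qed.

Lemma rec_has (X : context) (P : X -> nat -> bool) (n : X -> nat) :
  recursive (fun z : X * nat => P z.1 z.2) -> recursive n ->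
  recursive (fun x => has (P x) (iota 0 (n x))).
Proof.
move=> rP rn; suff : recursive (fun x => ~~ all (fun i => ~~ P x i) (iota 0 (n x))).
  by apply: rec_ext => x; rewrite -has_predC; apply: eq_has => i /=; rewrite negbK.
by apply/rec_negb/rec_all => //; apply: rec_negb.
Qed.

Lemma rec_code (X : context) (s : X -> seq nat) :
  recursive s -> recursive (fun x => CodeSeq.code (s x)).
Proof. by []. Qed.

(* The head symbol of the body is matched syntactically: plain unification
   would unfold it. *)
Ltac rec_step :=
  lazymatch goal with
  | |- recursive snd => exact: rec_var0
  | |- recursive (fun x => x.2) => exact: rec_var0
  | |- recursive (fun x => x.1.2) => exact: rec_var1
  | |- recursive (fun x => x.1.1.2) => exact: rec_var2
  | |- recursive (fun x => x.1.1.1.2) => exact: rec_var3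
  | |- recursive (fun x => nat_of_bool (@?b x)) => apply: (rec_natb (b := b))
  | |- recursive (fun x => S (@?b x)) => apply: (rec_succn (N := b))
  | |- recursive (fun x => predn _) => apply: rec_predn
  | |- recursive (fun x => addn _ _) => apply: rec_addn
  | |- recursive (fun x => subn _ _) => apply: rec_subn
  | |- recursive (fun x => muln _ _) => apply: rec_muln
  | |- recursive (fun x => expn _ _) => apply: rec_expn
  | |- recursive (fun x => negb _) => apply: rec_negb
  | |- recursive (fun x => andb _ _) => apply: rec_andb
  | |- recursive (fun x => orb _ _) => apply: rec_orb
  | |- recursive (fun x => implb _ _) => apply: rec_implyb
  | |- recursive (fun x => leq _ _) => apply: rec_leq
  | |- recursive (fun x => eq_op _ _) => apply: rec_eqn
  | |- recursive (fun x => odd _) => apply: rec_odd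
  | |- recursive (fun x => half _) => apply: rec_half
  | |- recursive (fun x => double _) => apply: rec_double
  | |- recursive (fun x => all _ _) => apply: rec_all
  | |- recursive (fun x => has _ _) => apply: rec_has
  | |- recursive (fun x => CodeSeq.code (@?s x)) => apply: (rec_code (s := s))
  | |- recursive (fun x => if _ then _ else _) => apply: rec_if
  | |- _ => first [assumption | exact: rec_const | eapply rec_orc; [by move=> ?|]]
  end.

(** * Pairs and finite sequences *)

Lemma rec_to_nat (X : context) (a b : X -> nat) :
  recursive a -> recursive b -> recursive (fun x => Cantor.to_nat (a x, b x)).
Proof.
move=> ra rb.
(* Twice the pairing is a polynomial by [Cantor.to_nat_spec], and a product of consecutive numbers
   is even. *)
suff : recursive (fun x => b x + ((b x + a x) * (b x + a x).+1)./2).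
  apply: rec_ext => x; apply/double_inj; rewrite doubleD even_halfK.
    by have := Cantor.to_nat_spec (a x) (b x); rewrite !multE !plusE !muln2.
  by rewrite oddM /=; case: odd.
by repeat rec_step.
Qed.

Lemma rec_of_nat_fst (X : context) (a : X -> nat) :
  recursive a -> recursive (fun x => (Cantor.of_nat (a x)).1).
Proof.
apply: (rec_fun1 (f := fun k => (Cantor.of_nat k).1)).
(* The second component is at most the code, which bounds the inner search. *)
apply: (rec_unique (f := fun z i =>
  has (fun j => Cantor.to_nat (i, j) == z.2) (iota 0 z.2.+1))).
  by repeat first [rec_step | apply: rec_to_nat].
move=> [p k] i; apply/hasP/eqP => [[j _ /eqP <-]|->].
  by rewrite Cantor.cancel_of_to.
exists (Cantor.of_nat k).2; last by rewrite -surjective_pairing Cantor.cancel_to_of.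
rewrite mem_iota ltnS /= -[X in _ <= X]Cantor.cancel_to_of.
case: (Cantor.of_nat k) => x y /=.
by have /leP := Cantor.to_nat_non_decreasing x y; apply: leq_trans; rewrite leq_addr.
Qed.

Lemma rec_of_nat_snd (X : context) (a : X -> nat) :
  recursive a -> recursive (fun x => (Cantor.of_nat (a x)).2).
Proof.
apply: (rec_fun1 (f := fun k => (Cantor.of_nat k).2)).
apply: (rec_unique (f := fun z j =>
    Cantor.to_nat ((Cantor.of_nat z.2).1, j) == z.2)) => [|[p k] j].
  by repeat first [rec_step | apply: rec_to_nat | apply: rec_of_nat_fst].
rewrite -[(p, k).2]/k; apply/eqP/eqP => [E|->]; last by rewrite -surjective_pairing Cantor.cancel_to_of.
by rewrite -[in RHS]E Cantor.cancel_of_to.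
Qed.

(** A list is encoded by its [CodeSeq.code], so that decoding is the identity on encodings. *)
Lemma rec_decode (X : context) (a : X -> nat) :
  recursive a -> recursive (fun x => CodeSeq.decode (a x)).
Proof. by move=> ra; apply/rec_enc; apply: rec_ext ra => x; apply/esym/CodeSeq.decodeK. Qed.

Lemma rec_cons (X : context) (a : X -> nat) (s : X -> seq nat) :
  recursive a -> recursive s -> recursive (fun x => a x :: s x).
Proof.
move=> ra /rec_code rs; apply/rec_enc => /=.
by repeat rec_step.
Qed.

Lemma code_eq0 s : (CodeSeq.code s == 0) = (s == [::]).
Proof. by case: s => //= n s; rewrite muln_eq0 expn_eq0. Qed.

Lemma ltn_code_behead n s : CodeSeq.code s < CodeSeq.code (n :: s).
Proof.
by rewrite /= (@leq_trans (CodeSeq.code s).*2.+1) ?ltnS -?addnn ?leq_addr //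
  leq_pmull ?expn_gt0.
Qed.

Lemma rec_head (X : context) (s : X -> seq nat) :
  recursive s -> recursive (fun x => head 0 (s x)).
Proof.
(* A list with head [h] and tail coded by [m] has the code [2 ^ h * m.*2.+1], which exceeds [m]; the
   empty list has code 0 and default head 0. *)
apply: rec_fun1; apply: (rec_unique (f := fun z h =>
    ((CodeSeq.code z.2 == 0) && (h == 0)) ||
    has (fun m => 2 ^ h * m.*2.+1 == CodeSeq.code z.2) (iota 0 (CodeSeq.code z.2)))).
  by repeat rec_step.
move=> [p [|k t]] h; first by rewrite /= orbF.
rewrite code_eq0; apply/hasP/eqP => [[m _ E]|->].
  have : CodeSeq.code (h :: CodeSeq.decode m) = CodeSeq.code (k :: t).
    by apply/eqP; rewrite /= CodeSeq.decodeK.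
  by move/(can_inj CodeSeq.codeK) => [].
exists (CodeSeq.code t) => //.
by rewrite mem_iota (ltn_code_behead k t).
Qed.

Lemma rec_behead (X : context) (s : X -> seq nat) :
  recursive s -> recursive (fun x => behead (s x)).
Proof.
apply: rec_fun1; apply/rec_enc; apply: (rec_unique (f := fun z m =>
    if CodeSeq.code z.2 == 0 then m == 0
    else 2 ^ (head 0 z.2) * m.*2.+1 == CodeSeq.code z.2)).
  by repeat first [rec_step | apply: rec_head].
move=> [p [|k t]] m //; rewrite code_eq0 /=.
by rewrite eqn_pmul2l ?expn_gt0 // eqSS (inj_eq double_inj).
Qed.

Lemma rec_drop (X : context) (n : X -> nat) (s : X -> seq nat) :
  recursive n -> recursive s -> recursive (fun x => drop (n x) (s x)).
Proof.
move=> rn rs; suff : recursive (fun x => iteri (n x) (fun _ => behead) (s x)).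
  apply: rec_ext => x; elim: (n x) => [|k IHk] /=; first by rewrite drop0.
  by rewrite IHk -drop1 drop_drop.
by apply: rec_iteri => //; apply: rec_behead; rec_atom.
Qed.

Lemma rec_nth (X : context) (s : X -> seq nat) (n : X -> nat) :
  recursive s -> recursive n -> recursive (fun x => nth 0 (s x) (n x)).
Proof.
move=> rs rn; apply: (rec_ext (F := fun x => head 0 (drop (n x) (s x)))).
  by move=> x; rewrite -nth0 nth_drop addn0.
exact/rec_head/rec_drop.
Qed.

Lemma rec_size (X : context) (s : X -> seq nat) :
  recursive s -> recursive (fun x => size (s x)).
Proof.
apply: rec_fun1; apply: (rec_least (f := fun z n => CodeSeq.code (drop n z.2) == 0)).
- by repeat first [rec_step | apply: rec_drop].
- by move=> [p t] /=; rewrite drop_size.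
by move=> [p t] i /= si; rewrite code_eq0 -size_eq0 size_drop subn_eq0 -ltnNge.
Qed.

Lemma rec_mkseq (X : context) (f : X -> nat -> nat) (n : X -> nat) :
  recursive (fun z : X * nat => f z.1 z.2) -> recursive n ->
  recursive (fun x => mkseq (f x) (n x)).
Proof.
move=> rf rn.
(* Entries are added at the head, so the list is built from its end: after [k] rounds it consists of
   the last [k] entries. *)
suff : recursive (fun x => iteri (n x) (fun i s => f x (n x - i.+1) :: s) [::]).
  apply: rec_ext => x; set N := n x; rewrite -[RHS](drop0).
  suff H k : k <= N -> iteri k (fun i s => f x (N - i.+1) :: s) [::] =
      drop (N - k) (mkseq (f x) N) by rewrite H // subnn.
  elim: k => [|k IHk] kN /=; first by rewrite subn0 drop_oversize ?size_mkseq.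
  rewrite {}IHk ?(ltnW kN) // [RHS](drop_nth 0) ?size_mkseq; last first.
    by rewrite ltn_subrL (leq_trans _ kN).
  by rewrite subnSK // nth_mkseq // ltn_subrL (leq_trans _ kN).
apply: (rec_iteri (g := fun x i s => f x (n x - i.+1) :: s)) => //; last by rec_atom.
apply: rec_cons; last by rec_atom.
apply: (rec_comp (h := fun z : X * seq nat * nat => (z.1.1, n z.1.1 - z.2.+1))) rf.
apply: reindexing_pair.
  exact: (reindexing_comp (reindexing_fst _ _) (reindexing_fst _ _)).
rec_step; last by rec_step; rec_step.
exact: (rec_wk _ (F := fun z => n z.1)) (rec_wk _ rn).
Qed.

Lemma rec_prefix (X : context) (s t : X -> seq nat) :
  recursive s -> recursive t -> recursive (fun x => prefix (s x) (t x)).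
Proof.
apply: (rec_fun2 (f := fun s t : seq nat => prefix s t)) => {s t}.
apply: (rec_ext (F := fun z : baire * seq nat * seq nat =>
  (size z.1.2 <= size z.2) &&
  all (fun i => nth 0 z.1.2 i == nth 0 z.2 i) (iota 0 (size z.1.2)))); last first.
  by repeat first [rec_step | apply: rec_nth | apply: rec_size].
move=> [[p s] t] /=; apply/andP/prefixP => [[st /allP E]|[r ->]].
  exists (drop (size s) t); rewrite -[LHS](cat_take_drop (size s)); congr cat.
  apply: (@eq_from_nth _ 0); rewrite size_takel // => i si.
  by rewrite nth_take //; apply/esym/eqP/E; rewrite mem_iota.
rewrite size_cat leq_addr; split=> //; apply/allP => i; rewrite mem_iota => /= si.
by rewrite nth_cat si.
Qed.

Ltac rec := repeat lazymatch goal with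
  | |- recursive (fun x => Cantor.to_nat (_, _)) => apply: rec_to_nat
  | |- recursive (fun x => fst (Cantor.of_nat _)) => apply: rec_of_nat_fst
  | |- recursive (fun x => snd (Cantor.of_nat _)) => apply: rec_of_nat_snd
  | |- recursive (fun x => CodeSeq.decode _) => apply: rec_decode
  | |- recursive (fun x => cons _ _) => apply: rec_cons
  | |- recursive (fun x => head 0 _) => apply: rec_head
  | |- recursive (fun x => behead _) => apply: rec_behead
  | |- recursive (fun x => nth 0 _ _) => apply: rec_nth
  | |- recursive (fun x => size _) => apply: rec_size
  | |- recursive (fun x => mkseq _ _) => apply: rec_mkseq
  | |- recursive (fun x => prefix _ _) => apply: rec_prefix
  | |- _ => rec_step
  end.

(** * Weihrauch reducibility *)

(** The elements of [B] may carry data or proofs about their oracles; a partial functional thus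
    becomes a total function on [B]. *)
Definition base (B : Type) (o : B -> baire) : context :=
  @Context B o (fun=> [::]) 0 (fun=> erefl).

Lemma recursive_computable B (o : B -> baire) (G : base o -> baire)
    (F : baire -> option baire) :
  recursive (fun z : base o * nat => G z.1 z.2) ->
  (forall p r, F p = Some r -> exists2 b, o b = p & G b = r) -> computable F.
Proof.
move=> [c cG] FG; exists c => p r /FG[b <- <-] n.
exact: (cG ((b : base o), n)).
Qed.

Lemma computable_recursive (F : baire -> option baire) B (o G : B -> baire) :
  computable F -> (forall b, F (o b) = Some (G b)) ->
  recursive (fun z : base o * nat => G z.1 z.2).
Proof. by move=> [c cF] FG; exists c => -[b n]; apply: (cF _ _ (FG b) n). Qed.

Fixpoint subst_oracle (d c : code) : code :=
  match c with
  | Oracle => Comp d [:: Proj 0]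
  | Comp f gs => Comp (subst_oracle d f) [seq subst_oracle d g | g <- gs]
  | PrimRec f g => PrimRec (subst_oracle d f) (subst_oracle d g)
  | Mu f => Mu (subst_oracle d f)
  | _ => c
  end.

Lemma eval_subst_oracle p q d c v y :
  computes d p q -> eval q c v y -> eval p (subst_oracle d c) v y.
Proof.
move=> dpq; move: c v y; fix IH 1 => -[||i||f gs|f g|f] v y //=.
- move=> ->; exists [:: nth 0 v 0]; first by constructor=> //; constructor.
  by rewrite nth0; apply: dpq.
- move=> [w gsw fw]; exists w; last exact: IH fw.
  move: gs w gsw {fw}; fix IHs 1 => -[|g gs] w gsw; inversion gsw; subst.
    by constructor.
  by constructor; [apply: IH | apply: IHs].
- elim: (head 0 v) y => [|n IHn] y /=; first exact: IH.
  by move=> [a /IHn aE ga]; exists a => //; apply: IH.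
- move=> [fy lty]; split; first exact: IH.
  by move=> i /lty[k fk]; exists k; apply: IH.
Qed.

Lemma computable_bind F G :
  computable F -> computable G -> computable (fun p => obind G (F p)).
Proof.
move=> [c cF] [d dG]; exists (subst_oracle c d) => p r.
case Fp : (F p) => [q|//] /= Gq n.
by apply: (eval_subst_oracle (q := q)); [apply: cF | apply: dG].
Qed.

Definition opair (F G : baire -> option baire) (p : baire) : option baire :=
  obind (fun q => omap (interleave q) (G p)) (F p).

Lemma computable_opair F G : computable F -> computable G -> computable (opair F G).
Proof.
move=> cF cG.
(* The oracles on which both maps are defined, together with the two values. *)
pose B := {b : baire * (baire * baire) | F b.1 = Some b.2.1 /\ G b.1 = Some b.2.2}.
pose o (b : B) := (sval b).1.
apply: (@recursive_computable _ o (fun b => interleave (sval b).2.1 (sval b).2.2)).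
  have rF : recursive (fun z : base o * nat => (sval z.1).2.1 z.2).
    by apply: (computable_recursive (G := fun b : B => (sval b).2.1) cF) => -[b []].
  have rG : recursive (fun z : base o * nat => (sval z.1).2.2 z.2).
    by apply: (computable_recursive (G := fun b : B => (sval b).2.2) cG) => -[b []].
  rewrite /interleave; apply: rec_if; first by rec.
    apply: (rec_comp (h := fun z : base o * nat => (z.1, z.2./2)) _ rG).
    by apply: reindexing_pair; [exact: reindexing_fst | rec].
  apply: (rec_comp (h := fun z : base o * nat => (z.1, z.2./2)) _ rF).
  by apply: reindexing_pair; [exact: reindexing_fst | rec].
move=> p r; rewrite /opair; case Fp : (F p) => [q|] //=; case Gp : (G p) => [s|] //= [<-].
by exists (exist _ (p, (q, s)) (conj Fp Gp)).
Qed.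

Lemma recursive_computable_some (G : baire -> baire) :
  recursive (fun z : baire * nat => G z.1 z.2) -> computable (fun p => Some (G p)).
Proof. by move=> [c cG]; exists c => p _ [<-] n; apply: (cG (p, n)). Qed.

Lemma computable_evens : computable (fun p => Some (evens p)).
Proof. by apply: recursive_computable_some; rewrite /evens; rec. Qed.

Lemma computable_odds : computable (fun p => Some (odds p)).
Proof. by apply: recursive_computable_some; rewrite /odds; rec. Qed.

Lemma weihrauch_le_trans (X Y Z W U V : rep_space)
    (f : problem X Y) (g : problem Z W) (h : problem U V) :
  weihrauch_le f g -> weihrauch_le g h -> weihrauch_le f h.
Proof.
move=> [Phi1 [Psi1 [cPhi1 cPsi1 fg]]] [Phi2 [Psi2 [cPhi2 cPsi2 gh]]].
pose fst p := Some (evens p); pose snd p := Some (odds p).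
exists (fun p => obind Phi2 (Phi1 p)).
(* From [p] and an answer of [h], the instance [Phi1 p] of [g] is rebuilt, [Psi2] turns it and the
   answer of [h] into an answer of [g], and [Psi1] gets this together with [p]. *)
exists (fun p => obind Psi1 (opair fst (fun p => obind Psi2
  (opair (fun p => obind Phi1 (fst p)) snd p)) p)).
split; first exact: computable_bind.
  apply: computable_bind => //; apply: computable_opair; first exact: computable_evens.
  apply: computable_bind => //; apply: computable_opair; last exact: computable_odds.
  by apply: computable_bind => //; exact: computable_evens.
move=> p x px fx; have [p' [z [Phi1p p'z gz {}fg]]] := fg p x px fx.
have [p'' [u [Phi2p p''u hu {}gh]]] := gh p' z p'z gz.
exists p'', u; split=> //; first by rewrite Phi1p.
move=> q v qv huv; have [r [w [Psi2E rw gzw]]] := gh q v qv huv.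
have [s [y [Psi1E sy fxy]]] := fg r w rw gzw.
exists s, y; split=> //.
rewrite /opair /fst /snd /= evens_interleave odds_interleave Phi1p /= Psi2E /=.
exact: Psi1E.
Qed.

(** [Psi] may exploit what [B] records about its oracles, for instance that a search ends. Which [b]
    is chosen over [interleave p q] is immaterial, since the last hypothesis covers all of them. *)
Lemma weihrauch_leI (X Y Z W : rep_space) (f : problem X Y) (g : problem Z W)
    (Phi : baire -> baire) B (o : B -> baire) (Psi : base o -> baire) :
  recursive (fun z : baire * nat => Phi z.1 z.2) ->
  recursive (fun z : base o * nat => Psi z.1 z.2) ->
  (forall p x, name p x -> exists z, [/\ name (Phi p) z, dom g z &
    forall q w, name q w -> g z w ->
      (exists b, o b = interleave p q) /\
      forall b, o b = interleave p q -> exists2 y, name (Psi b) y & f x y]) ->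
  weihrauch_le f g.
Proof.
move=> rPhi rPsi H; exists (fun p => Some (Phi p)).
exists (fun p => if pselect (exists b, o b = p) is left e
  then Some (Psi (projT1 (cid e))) else None).
split; first exact: recursive_computable_some.
  apply: (recursive_computable rPsi) => p r; case: pselect => // e [<-].
  by exists (projT1 (cid e)) => //; case: cid.
move=> p x px _; have [z [Phiz gz {}H]] := H p x px; exists (Phi p), z; split=> // q w qw gw.
have [e {}H] := H q w qw gw; case: pselect => // e'; case: cid => b bE /=.
by have [y ? ?] := H b bE; exists (Psi b), y.
Qed.

Theorem wCB_le_CB : weihrauch_le wCB CB.
Proof.
apply: (@weihrauch_leI _ _ _ _ wCB CB id baire id
  (* Keeps the kernel and the list, and drops the number between them. *)
  (fun p => interleave (evens (odds p)) (odds (odds (odds p))))).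
- by rec.
- by rewrite /interleave /evens /odds; rec.
move=> p T pT; exists T; split=> //; first exact: dom_CB.
move=> q [K [n bx]] [/= qK [_ qbx]] [/= KE bxE _ _]; split; first by exists (interleave p q).
move=> _ ->; rewrite odds_interleave; exists (K, bx) => //=.
by rewrite evens_interleave odds_interleave.
Qed.

(** * From well-foundedness to perfect kernels *)

(** Perfection gives every node a proper extension, and iterating a choice of these yields a
    path. *)
Lemma perfect_paths_through (T : tree) s :
  perfect T -> nodes T s -> paths_through T s !=set0.
Proof.
move=> pT Ts.
have /choice[g gP] : forall u, exists v, nodes T u ->
    [/\ nodes T v, prefix u v & size u < size v].
  move=> u; have [Tu|] := pselect (nodes T u); last by exists u.
  have [v [w [Tv Tw uv uw /andP[vw wv]]]] := pT u Tu; exists v => _; split=> //.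
  (* If [v] were [u] itself, it would be a prefix of [w]. *)
  move: uv vw wv => /prefixP[[|a r] ->]; last by rewrite size_cat /= addnS ltnS leq_addr.
  by rewrite cats0 uw.
pose S n := iter n g s.
have TS n : nodes T (S n) by elim: n => //= n /gP[].
have Ss n : prefix (S n) (S n.+1) by have [] := gP _ (TS n).
have SS m n : m <= n -> prefix (S m) (S n).
  move/subnK => <-; elim: (n - m) => [|k IHk]; first exact: prefix_refl.
  exact: prefix_trans IHk (Ss _).
have szS n : n <= size (S n).
  by elim: n => // n IHn; apply: (leq_ltn_trans IHn); have [] := gP _ (TS n).
(* [S k.+1] has length at least [k.+1], so this entry is never the default. *)
pose x k := nth 0 (S k.+1) k.
have xE m n : m <= size (S n) -> mkseq x m = take m (S n).
  move=> mn; apply: (@eq_from_nth _ 0); rewrite size_mkseq ?size_takel // => k km.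
  rewrite nth_mkseq // nth_take // /x.
  have nthE a b : a <= b -> k < size (S a) -> nth 0 (S a) k = nth 0 (S b) k.
    by move=> /SS/prefixP[r ->] ka; rewrite nth_cat ka.
  case/orP: (leq_total k.+1 n) => kn; first exact: nthE.
  by apply/esym/nthE => //; exact: leq_trans mn.
exists x; split=> [n|]; last by rewrite (xE _ 0) // take_size.
by rewrite (xE n n) //; apply: tree_closed (TS n); rewrite prefixE size_takel.
Qed.

Section Fan.
Variable T : nat -> tree.

(* Every entry of a node of [T i] is split in two, which makes the paths of
   the copy of [T i] at the node [:: i] a perfect set. *)
Definition fan_nodes : set (seq nat) :=
  [set s | if s is i :: t then nodes (T i) [seq k./2 | k <- t] else True].

Lemma fan_closed s t : prefix s t -> fan_nodes t -> fan_nodes s.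
Proof.
case: s t => [|i s] [|j t] //= /andP[/eqP-> /prefixP[r ->]].
by rewrite /fan_nodes /= map_cat; apply: tree_closed; apply: prefix_prefix.
Qed.

Definition fan : tree := Tree fan_closed.

(** Halving the entries of a path of the kernel through [[:: i]] gives a path of [T i]. Conversely,
    the sequences that halve to a given path of [T i] branch in two at every level, so that they
    form a perfect subtree. *)
Lemma PK_fan i : nodes (PK fan) [:: i] <-> ~ well_founded (T i).
Proof.
split=> [Ki|/eqP/set0P[x Tx]].
  have [x [Px xi]] := perfect_paths_through (@PK_perfect _) Ki.
  apply/eqP/set0P; exists (fun n => (x n.+1)./2) => n.
  have /PK_sub := Px n.+1; rewrite /mkseq /= (iotaDl 1 0) -!map_comp.
  by move: xi => /= [->].
pose P := [set s | if s is j :: t then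
  j = i /\ [seq k./2 | k <- t] = mkseq x (size t) else True].
have cP s t : prefix s t -> P t -> P s.
  case: s t => [|j s] [|k t] //= /andP[/eqP-> /prefixP[r ->]] [-> E]; split=> //.
  have := congr1 (take (size s)) E; rewrite map_cat take_size_cat ?size_map // => ->.
  by rewrite size_cat /mkseq -map_take take_iota (minn_idPl _) ?leq_addr.
apply: (@PK_largest _ (Tree cP)) => //= [s Ps|[|j t] //= [-> ->]]; last exact: Tx.
(* The root has no first entry yet; it is split above its extension [[:: i]]. *)
pose t := if s is j :: t then t else [::].
have [st tE] : prefix s (i :: t) /\ [seq k./2 | k <- t] = mkseq x (size t).
  case: (s) @t Ps => [|j u] //= [-> ?]; split=> //.
  by rewrite eqxx prefix_refl.
(* Both values of the last entry have the half [x (size t)]. *)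
pose u b := i :: rcons t (b + (x (size t)).*2).
have Pu (b : bool) : P (u b).
  by split=> //; rewrite map_rcons tE size_rcons mkseqS half_bit_double.
exists (u true), (u false); split=> //; try exact: Pu.
- by apply: prefix_trans st _; rewrite /= eqxx -cats1 prefix_prefix.
- by apply: prefix_trans st _; rewrite /= eqxx -cats1 prefix_prefix.
have H b c : prefix (u b) (u c) = (u b == u c).
  by rewrite prefixE take_oversize ?size_map ?size_rcons 1?eq_sym //= !size_rcons.
rewrite !H [X in _ && ~~ X]eq_sym andbb /u eqseq_cons eqseq_rcons !eqxx /=.
by rewrite add1n add0n eqn_leq ltnn.
Qed.

End Fan.

Definition fan_name (p : baire) (s : seq nat) : nat :=
  if size s == 0 then 1 else p (Cantor.to_nat (head 0 s,
    CodeSeq.code (mkseq (fun j => (nth 0 s j.+1)./2) (size s).-1))).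

Theorem parallelization_WF_le_wCB : weihrauch_le (parallelization WF) wCB.
Proof.
apply: (@weihrauch_leI _ _ _ _ (parallelization WF) wCB
  (fun p k => fan_name p (CodeSeq.decode k))
  baire id
  (* A truth value is read at argument 0 of its column, and [Cantor.of_nat] recovers the index of
     the column. The subtraction is there because the kernel contains [[:: i]] iff [T i] is
     ill-founded. *)
  (fun p k => 1 - evens (odds p) (CodeSeq.code [:: (Cantor.of_nat k).1]))).
- by rewrite /fan_name; rec.
- by rewrite /evens /odds; rec.
move=> p T pT; exists (fan T); split; last 1 first.
- move=> q [K bx] [/= qK _] [/= KE _]; split; first by exists (interleave p q).
  move=> _ ->; exists (fun i => `[< well_founded (T i) >]); last first.
    by move=> i; split=> /asboolP.
  move=> i; change (1 - evens (odds (interleave p q))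
    (CodeSeq.code [:: (Cantor.of_nat (Cantor.to_nat (i, 0))).1])
    = `[< well_founded (T i) >] :> nat).
  rewrite odds_interleave Cantor.cancel_of_to qK KE.
  have /asbool_equiv_eq -> := PK_fan T i; rewrite asbool_neg.
  by case: asbool.
- move=> s; rewrite /fan_name CodeSeq.codeK; case: s => [|i s] /=; first by rewrite asboolT.
  have := pT i [seq k./2 | k <- s]; rewrite /column => <-.
  congr (p (Cantor.to_nat (i, CodeSeq.code _))).
  apply: (@eq_from_nth _ 0); rewrite size_mkseq ?size_map // => k ks.
  by rewrite nth_mkseq // (nth_map 0).
exact: dom_wCB.
Qed.

(** * Ranks and scattered paths *)

Section Rank.
Variable T : tree.
Implicit Types s t u v a b : seq nat.

Definition fork s a b : Prop :=
  [/\ nodes T a, nodes T b, prefix s a, prefix s b & ~~ prefix a b && ~~ prefix b a].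

Lemma fork_prefix s t a b : prefix s t -> fork t a b -> fork s a b.
Proof. by move=> st [Ta Tb ta tb ab]; split=> //; apply: prefix_trans st _. Qed.

(* [lt t s]: the rank of [t] is less than that of [s], that is, some fork
   [(a, b)] of [s] is such that for every fork [(u, v)] of [t] the smaller of
   the ranks of [u] and [v] is less than those of both [a] and [b]. *)
Definition simulation (S : seq nat -> seq nat -> Prop) : Prop :=
  forall t s, S t s -> exists a b, fork s a b /\
    forall u v, fork t u v -> (S u a \/ S v a) /\ (S u b \/ S v b).

Definition lt t s : Prop := exists2 S, simulation S & S t s.

(** The rank of [t] is at most that of [s]: the former is the supremum of min(rank u, rank v) + 1
    over the forks (u, v) of [t]. *)
Definition le t s : Prop := forall u v, fork t u v -> lt u s \/ lt v s.

(** The fixed point equation: [lt] is itself a simulation, and remains one when a pair satisfying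
    the right-hand side is added. *)
Lemma ltP t s : lt t s <-> exists a b, [/\ fork s a b, le t a & le t b].
Proof.
have fwd t' s' : lt t' s' -> exists a b, [/\ fork s' a b, le t' a & le t' b].
  move=> [S simS /simS[a [b [sab tS]]]].
  exists a, b; split=> // u v /tS[ua ub].
    by case: ua; [left | right]; exists S.
  by case: ub; [left | right]; exists S.
split=> [/fwd//|[a [b [sab ta tb]]]].
exists (fun t' s' => (t' = t /\ s' = s) \/ lt t' s'); last by left.
move=> t' s' [[-> ->]|/fwd[a' [b' [sab' ta' tb']]]].
  by exists a, b; split=> // u v tuv; case: (ta _ _ tuv) (tb _ _ tuv) => ? [] ?;
    split; tauto.
by exists a', b'; split=> // u v tuv; case: (ta' _ _ tuv) (tb' _ _ tuv) => ? [] ?;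
  split; tauto.
Qed.

Lemma lt_prefix_r t s s' : prefix s s' -> lt t s' -> lt t s.
Proof.
move=> ss' /ltP[a [b [sab ta tb]]]; apply/ltP; exists a, b; split=> //.
exact: fork_prefix sab.
Qed.

Lemma lt_prefix_l t t' s : prefix t t' -> lt t s -> lt t' s.
Proof.
move=> tt' /ltP[a [b [sab ta tb]]]; apply/ltP; exists a, b; split=> // u v tuv.
  by apply: ta; apply: fork_prefix tuv.
by apply: tb; apply: fork_prefix tuv.
Qed.

Lemma lt_le t s : lt t s -> le t s.
Proof.
move=> /ltP[a [b [[_ _ sa _ _] ta _]]] u v /ta[]; last by right; apply: lt_prefix_r sa _.
by left; apply: lt_prefix_r sa _.
Qed.

(** By coinduction: the negation of [le], with swapped arguments, is a simulation. *)
Lemma lt_total s t : le s t \/ lt t s.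
Proof.
have [st|nst] := pselect (le s t); first by left.
right; exists (fun t s => ~ le s t) => // {s t nst} t s.
move=> /existsNP[a /existsNP[b /not_implyP[sab /not_orP[nat nbt]]]].
exists a, b; split=> // u v tuv; split; apply: contrapT => /not_orP[/contrapT au /contrapT av].
  by apply: nat; apply/ltP; exists u, v.
by apply: nbt; apply/ltP; exists u, v.
Qed.

Lemma le_refl s : le s s.
Proof. by have [//|/lt_le] := lt_total s s. Qed.

(** By coinduction: the composition of [lt] and [le] is a simulation. *)
Lemma lt_le_trans x y z : lt x y -> le y z -> lt x z.
Proof.
move=> xy yz; exists (fun x z => exists2 y, lt x y & le y z); last by exists y.
move=> {x y z xy yz} x z [y /ltP[a [b [yab xa xb]]] yz].
(* Of the fork of [y] that witnesses [lt x y], one member is below [z]; unfolding [lt c z] then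
   supplies the fork of [z]. *)
have [c xc cz] : exists2 c, le x c & lt c z.
  by have [az|bz] := yz _ _ yab; [exists a | exists b].
have [d [e [zde cd ce]]] := (ltP c z).1 cz.
exists d, e; split=> // u v xuv; have [uc|vc] := xc _ _ xuv.
  by split; left; exists c.
by split; right; exists c.
Qed.

Lemma lt_PK t s : nodes (PK T) s -> lt t s.
Proof.
move=> Ks; exists (fun _ s => nodes (PK T) s) => // {t s Ks} t s Ks.
move: Ks => /PK_perfect[a [b [Ka Kb sa sb ab]]]; exists a, b; split; last by split; left.
by split=> //; apply: PK_sub.
Qed.

Lemma lt_nodes t s : lt t s -> nodes T s.
Proof. by move=> /ltP[a [b [[Ta _ sa _ _] _ _]]]; apply: tree_closed sa Ta. Qed.

(** Outside of the kernel [lt] is thus well-founded. The nodes that bound some [t n] form a perfect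
    subtree: [le (t n) y] implies [lt (t n.+1) y], and this yields a fork of [y] whose members bound
    [t n.+1]. *)
Lemma descending_PK (t : nat -> seq nat) :
  (forall n, lt (t n.+1) (t n)) -> nodes (PK T) (t 0).
Proof.
move=> tlt; pose P := [set y | nodes T y /\ exists n, le (t n) y].
have cP s s' : prefix s s' -> P s' -> P s.
  move=> ss' [Ts' [n tn]]; split; first exact: tree_closed Ts'.
  by exists n => u v /tn[]us; [left | right]; apply: lt_prefix_r ss' _.
apply: (@PK_largest T (Tree cP)) => [s [Ts [n tns]]|s [] //|].
  have /ltP[a [b [sab ta tb]]] : lt (t n.+1) s by apply: lt_le_trans tns.
  exists a, b; have [Ta Tb sa sb ab] := sab.
  by split=> //=; split=> //; exists n.+1.
by split; [apply: lt_nodes (tlt 0) | exists 0; apply: le_refl].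
Qed.

Lemma lt_irreflP s : lt s s <-> nodes (PK T) s.
Proof. by split=> [ss|/lt_PK//]; apply: (@descending_PK (fun=> s)). Qed.

(** * Dead nodes and leading paths *)

Definition dead s : Prop := exists n, forall t,
  prefix s t -> size t = size s + n -> nodes T t -> lt t s.

Definition leads s t : Prop := [/\ prefix s t, nodes T t & ~ lt t s].

Lemma deadPn s : ~ dead s <->
  forall n, size s <= n -> exists2 t, leads s t & size t = n.
Proof.
split=> [Ds n sn|H [n Dn]].
  apply: contrapT => nt; apply: Ds; exists (n - size s) => t st tn Tt.
  rewrite subnKC // in tn.
  by apply: contrapT => nts; apply: nt; exists t.
by have [t [st Tt nts] /Dn] := H _ (leq_addr n (size s)); apply: contra_not nts; apply.
Qed.

Lemma leads_prefix s t t' : prefix s t -> prefix t t' -> leads s t' -> leads s t.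
Proof.
move=> st tt' [st' Tt' nt']; split=> //; first exact: tree_closed Tt'.
by apply: contra_not nt'; apply: lt_prefix_l.
Qed.

Lemma prefix_size_eq (s t : seq nat) : size s = size t -> prefix s t = (s == t).
Proof. by move=> st; rewrite prefixE st take_size eq_sym. Qed.

(** Distinct nodes of equal length above [s] form a fork of [s], and [le s s] makes one of its
    members smaller than [s]. *)
Lemma leads_unique s t u : size t = size u -> leads s t -> leads s u -> t = u.
Proof.
move=> tu [st Tt nts] [su Tu nus]; apply: contrapT => /eqP ntu.
suff : fork s t u by case/le_refl.
by split; rewrite // !prefix_size_eq // [u == t]eq_sym andbb.
Qed.

Definition leading_path s (x : baire) : Prop :=
  forall n, size s <= n -> leads s (mkseq x n).

(** At each level from [size s] on exactly one node leads from [s]; by uniqueness these nodes extend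
    one another. *)
Lemma leading_path_exists s : ~ dead s -> exists x, leading_path s x.
Proof.
move=> /deadPn Ls; pose l m := maxn m (size s).
have /choice[t tP] : forall m, exists t, leads s t /\ size t = l m.
  by move=> m; have [|t] := Ls (l m); [exact: leq_maxr | exists t].
have tt m n : m <= n -> prefix (t m) (t n).
  move=> mn; have [[smt _ _] tm] := tP m; have [nt tn] := tP n.
  have lmn : l m <= l n by rewrite /l geq_max leq_maxr leq_max mn.
  have -> : t m = take (l m) (t n); last by rewrite prefixE size_takel // tn.
  apply: (@leads_unique s); [by rewrite tm size_takel // tn | by case: (tP m) |].
  apply: leads_prefix (nt); last by rewrite prefixE size_takel // tn.
  have [stn _ _] := nt; rewrite prefixE in stn.
  by rewrite prefixE take_takel ?leq_maxr.
exists (fun m => nth 0 (t m.+1) m) => n sn.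
suff -> : mkseq (fun m => nth 0 (t m.+1) m) n = t n by case: (tP n).
have tn : size (t n) = n by rewrite (tP n).2 /l (maxn_idPl sn).
apply: (@eq_from_nth _ 0); rewrite size_mkseq ?tn // => k kn.
rewrite nth_mkseq //; have /prefixP[r ->] := tt _ _ kn.
by rewrite nth_cat (tP k.+1).2 leq_max ltnSn.
Qed.

Lemma leading_path_prefix s x : leading_path s x -> mkseq x (size s) = s.
Proof.
by move=> /(_ _ (leqnn _))[]; rewrite prefix_size_eq ?size_mkseq // => /eqP.
Qed.

Lemma leading_path_scattered s x : leading_path s x -> scattered_part T x.
Proof.
move=> sx; split=> [n|/(_ (size s))].
  have [_ Tx _] := sx _ (leq_maxr n (size s)).
  by apply: tree_closed Tx; apply/prefix_mkseq/leq_maxl.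
rewrite (leading_path_prefix sx) => Ks.
(* Every node is below a kernel node in [lt], but [s] leads to itself. *)
by have [_ _] := sx _ (leqnn _); apply; apply: lt_PK.
Qed.

Lemma leading_path_alive s x : leading_path s x -> ~ dead s.
Proof. by move=> sx; apply/deadPn => n /sx ?; exists (mkseq x n); rewrite ?size_mkseq. Qed.

(** If every prefix of [x] had a later one of smaller rank, [descending_PK] would put all of them
    into the kernel. The conclusion covers all [m] from some point on, so that several paths can be
    cut at a common level. *)
Lemma scattered_leading_path x : scattered_part T x ->
  exists n, forall m, n <= m -> leading_path (mkseq x m) x.
Proof.
move=> [Tx nKx].
have [n nP] : exists n, forall m, n <= m -> ~ lt (mkseq x m) (mkseq x n).
  apply: contrapT => /forallNP H; apply: nKx => n.
  have /choice[g gP] : forall n, exists m, lt (mkseq x m) (mkseq x n).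
    by move=> m; have /existsNP[k /not_implyP[_ /contrapT ?]] := H m; exists k.
  apply: (@descending_PK (fun k => mkseq x (iter k g n))) => k; exact: gP.
exists n => m nm k; rewrite size_mkseq => mk; split=> //; first exact: prefix_mkseq.
move=> /(lt_prefix_r (prefix_mkseq x nm)); apply: nP.
exact: leq_trans mk.
Qed.

Lemma scattered_partP x : scattered_part T x <-> exists s, leading_path s x.
Proof.
split=> [/scattered_leading_path[n /(_ _ (leqnn n))]|[s]]; first by exists (mkseq x n).
exact: leading_path_scattered.
Qed.

(** The members of the antichain may be arbitrary sequences: those outside of [T] and those in the
    kernel are dead. *)
Definition few k : Prop := forall c : nat -> seq nat,
  (forall i j, i < k -> j < k -> i != j -> ~~ prefix (c i) (c j)) ->
  exists2 i, i < k & dead (c i).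

(** Distinct scattered paths, cut at a high enough level, give an antichain without dead members;
    conversely, incomparable nodes that are not dead have distinct leading paths. *)
Lemma fewP k : few k <-> ~ (`I_k #<= scattered_part T)%card.
Proof.
split=> [fewk|nk c inc].
  move=> /pcard_leP/injfunPex[f fS finj].
  have /choice[n0 n0P] : forall i, exists n, i < k ->
      forall m, n <= m -> leading_path (mkseq (f i) m) (f i).
    move=> i; case: (ltnP i k) => [/fS/scattered_leading_path[n]|]; last by exists 0.
    by exists n.
  have /choice[d dP] : forall ij : nat * nat, exists n, f ij.1 <> f ij.2 ->
      f ij.1 n <> f ij.2 n.
    move=> [i j] /=; have [E|nE] := pselect (forall n, f i n = f j n).
      by exists 0 => fij; case: fij; apply/funext.
    by have /existsNP[n fn] := nE; exists n.
  (* Beyond the levels at which the paths begin to lead and the arguments at which two of them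
     differ. *)
  pose N := \max_(i < k) n0 i + (\max_(i < k) \max_(j < k) d (i : nat, j : nat)).+1.
  have [i j ik jk ij|i ik] := fewk (fun i => mkseq (f i) N).
    rewrite prefix_size_eq ?size_mkseq //; apply/eqP => E.
    have nf : f i <> f j.
      move=> /finj E'; move: ij; rewrite E' ?eqxx // inE; [exact: ik | exact: jk].
    apply: (dP (i, j) nf) => /=; have dN : d (i, j) < N.
      rewrite /N ltn_addl // ltnS.
      apply: leq_trans (leq_bigmax (Ordinal ik)).
      exact: (leq_bigmax (F := fun j : 'I_k => d (i, j : nat)) (Ordinal jk)).
    by rewrite -(nth_mkseq 0 (f i) dN) E nth_mkseq.
  apply: leading_path_alive; apply: (n0P i ik).
  by rewrite /N (leq_trans (leq_bigmax (F := fun i : 'I_k => n0 i) (Ordinal ik))) ?leq_addr.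
apply: contrapT => nd; apply: nk.
have /choice[x xP] : forall i, exists x, i < k -> leading_path (c i) x.
  move=> i; case: (ltnP i k) => [ik|]; last by exists id.
  have [|x] := @leading_path_exists (c i); last by exists x.
  by move=> di; apply: nd; exists i.
apply/pcard_leP/injfunPex; exists x => [i /xP|i j].
  exact: leading_path_scattered.
rewrite !inE => ik jk xij; apply: contrapT => /eqP ij.
have ci := xP i ik; have cj := xP j jk; rewrite -xij in cj.
have := inc i j ik jk ij; have := inc j i jk ik; rewrite eq_sym => /(_ ij).
(* Two nodes with a common leading path are initial segments of it, so the shorter is a prefix of
   the longer. *)
wlog cij : i j ik jk xij ij ci cj / size (c i) <= size (c j).
  move=> H; case/orP: (leq_total (size (c i)) (size (c j))) => [|cji]; first exact: H.
  by move=> nij nji; apply: (H j i) => //; rewrite 1?eq_sym // -xij.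
move=> _ /negP; apply.
by rewrite -(leading_path_prefix ci) -(leading_path_prefix cj) prefix_mkseq.
Qed.

End Rank.

(** * Queries as trees *)

Definition node (d : seq nat) (i : nat) : seq nat := CodeSeq.decode (nth 0 d i).

Definition in_tree (p : baire) (s : seq nat) : bool := p (CodeSeq.code s) == 1.

Definition is_fork (p : baire) (s a b : seq nat) : bool :=
  [&& in_tree p a, in_tree p b, prefix s a, prefix s b &
      ~~ prefix a b && ~~ prefix b a].

(* A function [f] claims [lt t s] by [f (code [:: code t; code s]) <> 0], this
   value being 1 + the code of the fork of [s] in question, and [dead s] by
   [f (code [:: code s]) = n + 1], with [n] as in [dead]; [f 0] is the number [k]
   in [few k].  In the checks, [f] is approximated by a value [lo] that is 0 and
   a truth value [hi] that is true where [f] is not known. *)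
Definition lt_check (p : baire) (lo : nat -> nat) (hi : pred nat) (d w : seq nat) :=
  (lo (CodeSeq.code [:: nth 0 d 0; nth 0 d 1]) != 0) ==>
  is_fork p (node d 1) (node w 0) (node w 1) &&
  (is_fork p (node d 0) (node d 2) (node d 3) ==>
   (hi (CodeSeq.code [:: nth 0 d 2; nth 0 w 0]) ||
    hi (CodeSeq.code [:: nth 0 d 3; nth 0 w 0])) &&
   (hi (CodeSeq.code [:: nth 0 d 2; nth 0 w 1]) ||
    hi (CodeSeq.code [:: nth 0 d 3; nth 0 w 1]))).

Definition lt_witness (lo : nat -> nat) (d : seq nat) : seq nat :=
  CodeSeq.decode (lo (CodeSeq.code [:: nth 0 d 0; nth 0 d 1])).-1.

Definition dead_check (p : baire) (lo : nat -> nat) (hi : pred nat) (d : seq nat) :=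
  (lo (CodeSeq.code [:: nth 0 d 1]) != 0) ==>
  [&& prefix (node d 1) (node d 0),
      size (node d 0) == size (node d 1) + (lo (CodeSeq.code [:: nth 0 d 1])).-1 &
      in_tree p (node d 0)] ==>
  hi (CodeSeq.code [:: nth 0 d 0; nth 0 d 1]).

Definition antichain (d : seq nat) (k : nat) : bool :=
  all (fun i => all (fun j => (i != j) ==> ~~ prefix (node d i) (node d j)) (iota 0 k))
    (iota 0 k).

(** The value [k = 0] leaves the positive number [f 0] free, and thereby asks for finiteness. *)
Definition few_check (k : nat) (lo : nat -> nat) (hi : pred nat) (d : seq nat) :=
  hi 0 && ((lo 0 != 0) ==> ((k == 0) || (k == lo 0)) &&
  (antichain d (lo 0) ==> has (fun i => hi (CodeSeq.code [:: nth 0 d i])) (iota 0 (lo 0)))).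

(** An even index [2q] asks for the claim with code [q], an odd one [2k + 1] for [few k], or for
    finiteness if [k = 0]. *)
Definition query_check (i : nat) (lo : nat -> nat) (hi : pred nat) (d : seq nat) :=
  if odd i then few_check i./2 lo hi d else hi i./2.

Definition check (p : baire) (i : nat) (lo : nat -> nat) (hi : pred nat) (d : seq nat) :=
  [&& lt_check p lo hi d (lt_witness lo d), dead_check p lo hi d & query_check i lo hi d].

(** Less information makes a check easier: a claim that is not known is void as a premise and
    granted as a conclusion. *)
Lemma check_mono p i lo lo' (hi hi' : pred nat) d :
  (forall q, lo q = 0 \/ lo q = lo' q) -> subpred hi' hi ->
  check p i lo' hi' d -> check p i lo hi d.
Proof.
move=> lolo hihi /and3P[c1 c2 c3]; apply/and3P; split.
- move: c1; rewrite /lt_check /lt_witness.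
  case: (lolo (CodeSeq.code [:: nth 0 d 0; nth 0 d 1])) => ->; first by [].
  move=> /implyP H; apply/implyP => /H/andP[-> /implyP{}H] /=; apply/implyP => /H.
  by move=> /andP[/orP H1 /orP H2]; apply/andP; split; apply/orP;
    [case: H1 | case: H2] => /hihi; [left | right | left | right].
- move: c2; rewrite /dead_check.
  case: (lolo (CodeSeq.code [:: nth 0 d 1])) => ->; first by [].
  move=> /implyP H; apply/implyP => /H{}H; apply/implyP => /(implyP H).
  exact: hihi.
move: c3; rewrite /query_check /few_check; case: odd; last exact: hihi.
move=> /andP[/hihi-> /=]; case: (lolo 0) => ->; first by [].
move=> /implyP H; apply/implyP => /H/andP[-> /implyP{}H] /=; apply/implyP => /H.
by move=> /hasP[j jk /hihi hj]; apply/hasP; exists j.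
Qed.

Lemma check_cont p i (f : baire) d : exists N, forall lo hi,
  (forall q, q < N -> lo q = f q) -> (forall q, q < N -> hi q = (f q != 0)) ->
  check p i lo hi d -> check p i f (fun q => f q != 0) d.
Proof.
pose w := lt_witness f d; pose c a b := CodeSeq.code [:: nth 0 d a; b].
(* All the positions at which the check for [d] reads [f]. *)
pose L := [:: c 0 (nth 0 d 1); c 2 (nth 0 w 0); c 3 (nth 0 w 0); c 2 (nth 0 w 1);
  c 3 (nth 0 w 1); CodeSeq.code [:: nth 0 d 1]; 0; i./2] ++
  [seq CodeSeq.code [:: nth 0 d j] | j <- iota 0 (f 0)].
pose N := (\max_(q <- L) q).+1.
have LN q : q \in L -> q < N by move=> qL; rewrite ltnS; apply: leq_bigmax_seq.
exists N => lo hi loE hiE.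
have wE : lt_witness lo d = w.
  by rewrite /lt_witness loE //; apply: LN; rewrite !inE eqxx.
rewrite /check wE -/w /lt_check /dead_check /query_check /few_check !loE ?hiE //;
  do ?by apply: LN; rewrite mem_cat !inE eqxx ?orbT.
have -> : has (fun j => hi (CodeSeq.code [:: nth 0 d j])) (iota 0 (f 0)) =
    has (fun j => f (CodeSeq.code [:: nth 0 d j]) != 0) (iota 0 (f 0)); last by [].
by apply: eq_in_has => j jf; apply/hiE/LN; rewrite mem_cat (map_f _ jf) orbT.
Qed.

(** * The query trees *)

Definition known (sg : seq nat) : pred nat := fun q => (size sg <= q) || (nth 0 sg q != 0).

(** Only the challenges with code below the length are examined, which keeps membership decidable;
    along a path every challenge has its turn. *)
Definition query_nodes (p : baire) (i : nat) (sg : seq nat) : bool :=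
  all (fun n => check p i (nth 0 sg) (known sg) (CodeSeq.decode n)) (iota 0 (size sg)).

Lemma query_closed p i s t : prefix s t -> query_nodes p i t -> query_nodes p i s.
Proof.
move=> /prefixP[r ->] /allP H; apply/allP => n; rewrite mem_iota add0n => /= ns.
have nr : n \in iota 0 (size (s ++ r)) by rewrite mem_iota size_cat add0n /= ltn_addr.
apply: check_mono (H n nr) => q; rewrite /known nth_cat.
  by case: ltnP; [right | left; rewrite nth_default].
by rewrite size_cat; case: ltnP => //= qs; rewrite leqNgt ltn_addr.
Qed.

Definition query (p : baire) (i : nat) : tree :=
  @Tree (fun sg => query_nodes p i sg) (@query_closed p i).

(** Along a path each [d] is examined at prefixes long enough for [check_cont]; conversely,
    [check_mono] carries the checks from [f] to its prefixes. *)
Lemma query_path p i : ~ well_founded (query p i) <->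
  exists f : baire, forall d, check p i f (fun q => f q != 0) d.
Proof.
split=> [/eqP/set0P[f Qf]|[f fP]].
  exists f => d; have [N NP] := check_cont p i f d.
  pose K := maxn N (CodeSeq.code d).+1.
  have /allP/(_ (CodeSeq.code d)) := Qf K.
  rewrite mem_iota add0n size_mkseq /= CodeSeq.codeK => /(_ (leq_maxr _ _)).
  apply: NP => q qN; rewrite /known ?size_mkseq nth_mkseq ?(leq_trans qN) ?leq_maxl //.
  by rewrite leqNgt (leq_trans qN) ?leq_maxl.
apply/eqP/set0P; exists f => N; apply/allP => n _.
apply: check_mono (fP _) => q; rewrite /known ?size_mkseq; case: (ltnP q N) => //= qN.
- by right; rewrite nth_mkseq.
- by left; rewrite nth_default ?size_mkseq.
- by rewrite nth_mkseq.
Qed.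

(** * Meaning of the ill-foundedness of the query trees *)

Section Meaning.
Variables (p : baire) (T : tree).
Hypothesis pT : @name Tr p T.

Lemma in_treeP s : reflect (nodes T s) (in_tree p s).
Proof. by rewrite /in_tree pT; case: asboolP => ?; constructor. Qed.

Lemma is_forkP s a b : reflect (fork T s a b) (is_fork p s a b).
Proof.
apply: (iffP and5P) => -[Ta Tb sa sb ab]; split=> //; exact/in_treeP.
Qed.

Local Notation "f |= q" := (f (CodeSeq.code q) != 0) (at level 70).

(** The pairs claimed by [f] form a simulation. *)
Lemma check_lt i (f : baire) t s :
  (forall d, check p i f (fun q => f q != 0) d) ->
  f |= [:: CodeSeq.code t; CodeSeq.code s] -> lt T t s.
Proof.
move=> fP fts; exists (fun t s => f |= [:: CodeSeq.code t; CodeSeq.code s]) => //.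
move=> {t s fts} t s fts.
(* The witness depends on [t] and [s] only, so that a single fork of [s] serves for all forks
   [(u, v)] of [t]. *)
pose w := lt_witness f [:: CodeSeq.code t; CodeSeq.code s].
have wP u v : fork T s (node w 0) (node w 1) /\ (fork T t u v ->
    (f |= [:: CodeSeq.code u; CodeSeq.code (node w 0)] \/
     f |= [:: CodeSeq.code v; CodeSeq.code (node w 0)]) /\
    (f |= [:: CodeSeq.code u; CodeSeq.code (node w 1)] \/
     f |= [:: CodeSeq.code v; CodeSeq.code (node w 1)])).
  have /and3P[c1 _ _] := fP [seq CodeSeq.code x | x <- [:: t; s; u; v]].
  have /andP[/is_forkP + /implyP c2] := implyP c1 fts.
  rewrite /node /= !CodeSeq.codeK !CodeSeq.decodeK in c2 * => sab; split=> // /is_forkP/c2.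
  by move=> /andP[/orP ? /orP ?].
exists (node w 0), (node w 1); split; first by case: (wP [::] [::]).
by move=> u v; have [] := wP u v.
Qed.

Lemma check_dead i (f : baire) s :
  (forall d, check p i f (fun q => f q != 0) d) ->
  f |= [:: CodeSeq.code s] -> dead T s.
Proof.
move=> fP fs; exists (f (CodeSeq.code [:: CodeSeq.code s])).-1 => t st ts /in_treeP Tt.
apply: (check_lt fP); have /and3P[_ c2 _] := fP [:: CodeSeq.code t; CodeSeq.code s].
move/implyP: (implyP c2 fs); rewrite /node /= !CodeSeq.codeK; apply.
by rewrite st Tt ts eqxx.
Qed.

Lemma check_few i (f : baire) : odd i ->
  (forall d, check p i f (fun q => f q != 0) d) ->
  [/\ 0 < f 0, (i./2 == 0) || (i./2 == f 0) & few T (f 0)].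
Proof.
move=> oi fP.
have fewd d : f 0 != 0 /\ ((i./2 == 0) || (i./2 == f 0)) /\ (antichain d (f 0) ->
    has (fun i => f |= [:: nth 0 d i]) (iota 0 (f 0))).
  have /and3P[_ _] := fP d; rewrite /query_check oi => /andP[f0].
  by move=> /implyP/(_ f0)/andP[-> /implyP].
have [f0 [ik _]] := fewd [::]; split=> //; first by rewrite lt0n.
(* The given antichain, in coded form, is the challenge. *)
move=> c inc; pose d := mkseq (fun j => CodeSeq.code (c j)) (f 0).
have dE j : j < f 0 -> nth 0 d j = CodeSeq.code (c j) by move=> jk; rewrite nth_mkseq.
have [_ [_]] := fewd d; case/(_ _)/hasP => [|j].
  apply/allP => a; rewrite mem_iota add0n => /= ak; apply/allP => b; rewrite mem_iota add0n => /= bk.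
  by apply/implyP => ab; rewrite /node !dE // !CodeSeq.codeK inc.
by rewrite mem_iota add0n => /= jk; rewrite dE // => /(check_dead fP) ?; exists j.
Qed.

(** Making all true claims, with chosen witnesses, passes the checks; this gives the paths of the
    query trees with a positive answer. *)
Lemma claims_exist k : exists f : baire, [/\ f 0 = k,
  (forall s, dead T s -> f |= [:: CodeSeq.code s]),
  (forall t s, lt T t s -> f |= [:: CodeSeq.code t; CodeSeq.code s]) &
  forall d, lt_check p f (fun q => f q != 0) d (lt_witness f d) &&
            dead_check p f (fun q => f q != 0) d].
Proof.
(* The length of the decoded list tells the kind of claim; [k] sits at 0, the code of the empty
   list. *)
pose P q v := match CodeSeq.decode q with
  | [::] => v = k
  | [:: c] => let s := CodeSeq.decode c in
      (dead T s -> v != 0) /\ (v != 0 -> forall t,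
        prefix s t -> size t = size s + v.-1 -> nodes T t -> lt T t s)
  | [:: c; e] => let t := CodeSeq.decode c in let s := CodeSeq.decode e in
      let w := CodeSeq.decode v.-1 in
      (lt T t s -> v != 0) /\ (v != 0 ->
        [/\ fork T s (node w 0) (node w 1), le T t (node w 0) & le T t (node w 1)])
  | _ => True
  end.
have /choice[f fP] : forall q, exists v, P q v.
  move=> q; rewrite /P; case: (CodeSeq.decode q) => [|c [|e [|? ?]]];
    [by exists k | | | by exists 0].
    have [[n sn]|] := pselect (dead T (CodeSeq.decode c)); last by exists 0.
    by exists n.+1.
  have [/ltP[a [b [sab ta tb]]]|] := pselect (lt T (CodeSeq.decode c) (CodeSeq.decode e));
    last by exists 0.
  exists (CodeSeq.code [:: CodeSeq.code a; CodeSeq.code b]).+1; split=> // _.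
  by rewrite succnK CodeSeq.codeK /node /= !CodeSeq.codeK.
have f1 c := fP (CodeSeq.code [:: c]); have f2 c e := fP (CodeSeq.code [:: c; e]).
rewrite /P in f1 f2.
have {}f1 c : (dead T (CodeSeq.decode c) -> f |= [:: c]) /\ (f |= [:: c] -> forall t,
    prefix (CodeSeq.decode c) t ->
    size t = size (CodeSeq.decode c) + (f (CodeSeq.code [:: c])).-1 -> nodes T t ->
    lt T t (CodeSeq.decode c)).
  by have := f1 c; rewrite CodeSeq.codeK.
have {}f2 c e : (lt T (CodeSeq.decode c) (CodeSeq.decode e) -> f |= [:: c; e]) /\
   (f |= [:: c; e] -> let w := CodeSeq.decode (f (CodeSeq.code [:: c; e])).-1 in
    [/\ fork T (CodeSeq.decode e) (node w 0) (node w 1),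
        le T (CodeSeq.decode c) (node w 0) & le T (CodeSeq.decode c) (node w 1)]).
  by have := f2 c e; rewrite CodeSeq.codeK.
exists f; split=> [|s ds|t s ts|d].
- exact: (fP 0).
- by apply: (f1 _).1; rewrite CodeSeq.codeK.
- by apply: (f2 _ _).1; rewrite !CodeSeq.codeK.
apply/andP; split; apply/implyP.
  move=> /(f2 _ _).2; rewrite -/(lt_witness f d); set w := lt_witness f d => -[sab ta tb].
  apply/andP; split; first exact/is_forkP.
  apply/implyP => /is_forkP tuv; apply/andP.
  by split; [case: (ta _ _ tuv) | case: (tb _ _ tuv)] => /(f2 _ _).1 ->; rewrite ?orbT.
move=> /(f1 _).2 H; apply/implyP => /and3P[st /eqP ts /in_treeP Tt].
by apply: (f2 _ _).1; apply: H.
Qed.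

Lemma query_lt t s :
  ~ well_founded (query p (CodeSeq.code [:: CodeSeq.code t; CodeSeq.code s]).*2) <-> lt T t s.
Proof.
rewrite query_path; split=> [[f fP]|ts].
  apply: (check_lt fP); have /and3P[_ _] := fP [::].
  by rewrite /query_check odd_double doubleK.
have [f [_ _ f2 fP]] := claims_exist 0; exists f => d; rewrite /check andbA fP.
by rewrite /query_check odd_double doubleK f2.
Qed.

Lemma query_dead s :
  ~ well_founded (query p (CodeSeq.code [:: CodeSeq.code s]).*2) <-> dead T s.
Proof.
rewrite query_path; split=> [[f fP]|ds].
  apply: (check_dead fP); have /and3P[_ _] := fP [::].
  by rewrite /query_check odd_double doubleK.
have [f [_ f1 _ fP]] := claims_exist 0; exists f => d; rewrite /check andbA fP.
by rewrite /query_check odd_double doubleK f1.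
Qed.

Lemma few_query k j : 0 < k -> few T k -> (j == 0) || (j == k) ->
  ~ well_founded (query p j.*2.+1).
Proof.
move=> k0 fk jk; apply/query_path.
have [f [f0 f1 _ fP]] := claims_exist k; exists f => d; rewrite /check andbA fP.
rewrite /query_check /= odd_double uphalf_double /few_check f0 jk -lt0n k0 /=.
apply/implyP => ad; have [i j' ik jk' ij|i ik di] := fk (node d).
  have /allP/(_ i) := ad; rewrite mem_iota add0n => /(_ ik)/allP/(_ j').
  by rewrite mem_iota add0n ij => /(_ jk').
apply/hasP; exists i; first by rewrite mem_iota add0n.
by move: (f1 _ di); rewrite CodeSeq.decodeK.
Qed.

Lemma query_few k : 0 < k -> ~ well_founded (query p k.*2.+1) <-> few T k.
Proof.
move=> k0; split=> [/query_path[f fP]|fk]; last by apply: (few_query k0 fk); rewrite eqxx orbT.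
have /= := check_few _ fP; rewrite odd_double uphalf_double => /(_ isT)[_ + fk].
by rewrite eqn0Ngt k0 /= => /eqP ->.
Qed.

Lemma query_finite :
  ~ well_founded (query p 1) <-> finite_set (scattered_part T).
Proof.
split=> [/query_path[f /check_few[//|_ _ /fewP fk]]|[k kS]].
  apply: contrapT => /infiniteP nS; apply: fk; apply: card_le_trans nS.
  exact: subset_card_le.
(* Exactly [k] scattered paths leave no room for [k.+1] of them. *)
apply: (@few_query k.+1 0) => //; apply/fewP.
by rewrite (card_le_eqr kS) card_le_II ltnn.
Qed.

End Meaning.

(** * Reading off the answers *)

Lemma rec_ex_minn (X : context) (f : X -> nat -> bool) (ex : forall x, exists n, f x n) :
  recursive (fun z : X * nat => f z.1 z.2) -> recursive (fun x => ex_minn (ex x)).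
Proof.
move=> rf; apply: (rec_least rf) => x; case: ex_minnP => // n _ nmin.
by move=> i; rewrite ltnNge; apply: contra; apply: nmin.
Qed.

Lemma column_of_nat (F : nat -> baire) i :
  column (fun k => F (Cantor.of_nat k).1 (Cantor.of_nat k).2) i = F i.
Proof. by apply/funext => n; rewrite /column Cantor.cancel_of_to. Qed.

Definition answer (z : baire) (i : nat) : nat := odds z (Cantor.to_nat (i, 0)).

Definition alive (z : baire) (j : nat) : bool := answer z (CodeSeq.code [:: j]).*2 != 0.

(** For a dead [j] every [c] passes, so that the search for [c] always ends. The length is at least
    [m.+1], so that the entry [m] exists. *)
Definition leads_test (z : baire) (j m c : nat) : bool :=
  alive z j ==>
  [&& prefix (CodeSeq.decode j) (CodeSeq.decode c),
      size (CodeSeq.decode c) == maxn m.+1 (size (CodeSeq.decode j)),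
      in_tree (evens z) (CodeSeq.decode c) &
      answer z (CodeSeq.code [:: c; j]).*2 != 0].

(** Query 1 has the answer 0 iff the scattered part is finite. Then [few k] holds iff [k] exceeds
    its cardinality, so that the least [k] is the number that [CB] asks for. *)
Definition count_test (z : baire) (k : nat) : bool :=
  if answer z 1 == 0 then (0 < k) && (answer z k.*2.+1 == 0) else k == 0.

Definition answered (z : baire) (T : tree) : Prop :=
  @name Tr (evens z) T /\
  forall i, answer z i = `[< well_founded (query (evens z) i) >] :> nat.

Section Answered.
Variables (z : baire) (T : tree).
Hypothesis zT : answered z T.

Lemma answer_neq0 i : answer z i != 0 <-> well_founded (query (evens z) i).
Proof. by rewrite zT.2; case: asboolP. Qed.

Lemma answer_eq0 i : answer z i == 0 <-> ~ well_founded (query (evens z) i).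
Proof. by rewrite zT.2; case: asboolP. Qed.

Lemma aliveP j : reflect (~ dead T (CodeSeq.decode j)) (alive z j).
Proof.
apply: (iffP idP); rewrite -(query_dead zT.1) CodeSeq.decodeK; last first.
  by move/contrapT/answer_neq0.
by move=> /answer_neq0 wf /(_ wf).
Qed.

Lemma leads_testP j m c : reflect
  (alive z j -> leads T (CodeSeq.decode j) (CodeSeq.decode c) /\
    size (CodeSeq.decode c) = maxn m.+1 (size (CodeSeq.decode j)))
  (leads_test z j m c).
Proof.
have ltE : answer z (CodeSeq.code [:: c; j]).*2 != 0 <->
    ~ lt T (CodeSeq.decode c) (CodeSeq.decode j).
  rewrite -(query_lt zT.1) !CodeSeq.decodeK answer_neq0.
  by split=> [wf /(_ wf)|/contrapT].
apply: (iffP implyP) => H /H.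
  by move=> /and4P[? /eqP ? /(in_treeP zT.1) ? /ltE].
by move=> [[-> /(in_treeP zT.1)-> /ltE->] ->]; rewrite eqxx.
Qed.

Lemma leads_test_exists j m : exists c, leads_test z j m c.
Proof.
have [/aliveP/deadPn H|nj] := boolP (alive z j); last first.
  by exists 0; apply/leads_testP; rewrite (negPf nj).
have [t st tm] := H _ (leq_maxr m.+1 _).
by exists (CodeSeq.code t); apply/leads_testP; rewrite CodeSeq.codeK.
Qed.

Lemma count_test_exists : exists k, count_test z k.
Proof.
rewrite /count_test; case: (boolP (answer z 1 == 0)); last by exists 0.
move=> /answer_eq0/(query_finite zT.1)[k kS].
exists k.+1; apply/answer_eq0/(query_few zT.1) => //; apply/fewP.
by rewrite (card_le_eqr kS) card_le_II ltnn.
Qed.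

Lemma count_test_infinite k : infinite_set (scattered_part T) -> count_test z k -> k = 0.
Proof.
rewrite /count_test; case: ifPn => [/answer_eq0/(query_finite zT.1)//|_ _ /eqP//].
Qed.

Lemma count_test_finite j k : (scattered_part T #= `I_j)%card ->
  count_test z k = (j < k).
Proof.
move=> jS; rewrite /count_test.
have /(query_finite zT.1)/answer_eq0-> : finite_set (scattered_part T) by exists j.
case: k => // k; rewrite ltn0Sn andTb; apply/idP/idP.
  move=> /answer_eq0/(query_few zT.1 (ltn0Sn k))/fewP/negP.
  by rewrite (card_le_eqr jS) card_le_II -ltnNge.
move=> jk; apply/answer_eq0/(query_few zT.1 (ltn0Sn k))/fewP.
by rewrite (card_le_eqr jS) card_le_II; apply/negP; rewrite -ltnNge.
Qed.

End Answered.

(** The oracles on which the searches for nodes and for the number are known to end. *)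
Definition valid : Type := {z : baire | exists T, answered z T}.

Local Notation valid_orc := (@proj1_sig baire (fun z => exists T, answered z T)).

Lemma valid_leads (b : valid) j m : exists c, leads_test (valid_orc b) j m c.
Proof. by have [T bT] := svalP b; exact: (leads_test_exists bT). Qed.

Lemma valid_count (b : valid) : exists k, count_test (valid_orc b) k.
Proof. by have [T bT] := svalP b; exact: (count_test_exists bT). Qed.

Definition path_out (b : valid) (j m : nat) : nat :=
  nth 0 (CodeSeq.decode (ex_minn (valid_leads b j m))) m.

(** A node is in the kernel iff it is below itself in [lt], by [lt_irreflP]; hence the query for the
    pair [(k, k)]. Entry [j] of the list belongs to the node coded by [j]: its leading path, or a
    junk value with bit 0 if the node is dead. *)
Definition CB_out (b : valid) : baire :=
  interleave (fun k => 1 - answer (valid_orc b) (CodeSeq.code [:: k; k]).*2)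
  (interleave (fun=> ex_minn (valid_count b))
  (fun k => interleave (fun=> alive (valid_orc b) (Cantor.of_nat k).1)
    (path_out b (Cantor.of_nat k).1) (Cantor.of_nat k).2)).

Lemma rec_CB_out : recursive (fun z : base valid_orc * nat => CB_out z.1 z.2).
Proof.
have rc : recursive (fun b : base valid_orc => ex_minn (valid_count b)).
  apply: rec_ex_minn.
  by rewrite /count_test /answer /odds; rec.
have rp : recursive (fun z : base valid_orc * nat * nat => path_out z.1.1 z.1.2 z.2).
  rewrite /path_out; rec.
  apply: (@rec_ex_minn _ _ (fun z : base valid_orc * nat * nat => valid_leads z.1.1 z.1.2 z.2)).
  by rewrite /leads_test /maxn /alive /answer /odds /in_tree /evens; rec.
rewrite /CB_out /interleave /alive /answer /odds; rec.
  apply: (rec_comp (h := fun z : base valid_orc * nat =>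
    (z.1, (Cantor.of_nat z.2./2./2).1, (Cantor.of_nat z.2./2./2).2./2)) _ rp).
  by do 2!(apply: reindexing_pair; last by rec); exact: reindexing_fst.
by apply: (rec_comp (h := fst)) rc; exact: reindexing_fst.
Qed.

(** By [leads_unique], whatever node the search finds is an initial segment of [x]. *)
Lemma path_out_leading (b : valid) T j x : answered (valid_orc b) T ->
  leading_path T (CodeSeq.decode j) x -> path_out b j = x.
Proof.
move=> bT jx; apply/funext => m; rewrite /path_out; case: ex_minnP => c.
move=> /(leads_testP bT)/(_ _)[|jc cm _]; first exact/(aliveP bT)/(leading_path_alive jx).
have /(leads_unique _ jc)-> := jx _ (leq_maxr m.+1 _); last by rewrite size_mkseq cm.
by rewrite nth_mkseq // leq_maxl.
Qed.

Lemma CB_out_correct (b : valid) T : answered (valid_orc b) T ->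
  exists2 y, @name (prodS Tr (prodS natS (seqS (prodS boolS baireS)))) (CB_out b) y &
    CB T y.
Proof.
move=> bT; exists (PK T, (ex_minn (valid_count b), fun i =>
    (alive (valid_orc b) i, path_out b i))).
  split; rewrite /CB_out ?evens_interleave ?odds_interleave.
    move=> s; change (1 - answer (valid_orc b)
      (CodeSeq.code [:: CodeSeq.code s; CodeSeq.code s]).*2 = `[< nodes (PK T) s >] :> nat).
    rewrite bT.2; set A := well_founded _.
    suff -> : nodes (PK T) s = ~ A by rewrite asbool_neg; case: asboolP.
    by apply/propext; rewrite -lt_irreflP -(query_lt bT.1).
  split; first by rewrite evens_interleave.
  move=> i; rewrite odds_interleave (column_of_nat (fun i =>
    interleave (fun=> alive (valid_orc b) i) (path_out b i))).
  by split; rewrite ?evens_interleave ?odds_interleave.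
split=> //=.
- apply/seteqP; split=> [x /scattered_partP[s sx]|x [i [/(aliveP bT) ai <-]]].
    exists (CodeSeq.code s); congr pair.
      by apply/(aliveP bT); rewrite CodeSeq.codeK; apply: leading_path_alive sx.
    by apply: (path_out_leading bT); rewrite CodeSeq.codeK.
  have [y iy] := leading_path_exists ai.
  by rewrite (path_out_leading bT iy); apply: leading_path_scattered iy.
- by move=> infS; case: ex_minnP => n /(count_test_infinite bT infS).
move=> k kS; case: ex_minnP => n; rewrite (count_test_finite bT _ kS) => kn nmin.
by apply/eqP; rewrite eqn_leq kn nmin // (count_test_finite bT _ kS).
Qed.

Theorem CB_le_parallelization_WF : weihrauch_le CB (parallelization WF).
Proof.
apply: (@weihrauch_leI _ _ _ _ CB (parallelization WF)
  (fun p k => query_nodes p (Cantor.of_nat k).1 (CodeSeq.decode (Cantor.of_nat k).2))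
  valid valid_orc CB_out _ rec_CB_out).
  rewrite /query_nodes /check /lt_check /lt_witness /dead_check /query_check /few_check.
  by rewrite /antichain /is_fork /in_tree /node /known; rec.
move=> p T pT; exists (query p); split.
- move=> i s; rewrite /column Cantor.cancel_of_to CodeSeq.codeK.
  by rewrite -[in LHS](asboolb (query_nodes p i s)).
- by exists (fun i => `[< well_founded (query p i) >]) => i; split=> /asboolP.
move=> q w qw wQ.
have bT : answered (interleave p q) T.
  split; rewrite evens_interleave // => i; rewrite /answer odds_interleave.
  have := qw i; rewrite /column => ->; congr nat_of_bool.
  by apply/idP/asboolP => /(wQ i).
split; first by exists (exist _ (interleave p q) (ex_intro _ T bT)).
by move=> b bE; apply: CB_out_correct; rewrite bE.
Qed.

Theorem proposition4p34 :
  weihrauch_equiv wCB CB /\ weihrauch_equiv CB (parallelization WF).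
Proof.
have CB_wCB : weihrauch_le CB wCB.
  exact: weihrauch_le_trans CB_le_parallelization_WF parallelization_WF_le_wCB.
split; split=> //; first exact: wCB_le_CB.
- exact: CB_le_parallelization_WF.
exact: weihrauch_le_trans parallelization_WF_le_wCB wCB_le_CB.
Qed.
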